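(* Let $X$ be a metric space and let $s>0$. If $X$ has finite $s$-packing content, then the following hold at $\mathcal{H}^s$-a.e. $x\in X$: (1) $\mathrm{AppTan}_{\mathrm{GH}}(X,x,s)=\mathrm{Tan}_{\mathrm{GH}}(X,x)$; (2) if $(Y,y)$ is a strong approximate $s$-tangent of $X$ at $x$, then $\mathrm{Tan}_{\mathrm{GH}}(X,x)=\{[(Y,y)]\}$, where $[(Y,y)]$ is the pointed isometry class of $(Y,y)$.
   Context: Hausdorff measure: $\mathcal{H}^s(A)=\lim_{\delta\to0}\inf\{\sum_i(\operatorname{diam}U_i)^s: A\subset\bigcup_iU_i,\ \operatorname{diam}U_i\le\delta\}$. A metric space $X$ has finite $s$-packing content if there is $M\in(0,\infty)$ such that $\sum_ir(B_i)^s<M$ for every countable collection of mutually disjoint closed balls $B_i\subset X$ with radii $r(B_i)\le\operatorname{diam}X$. $B_X(x,r)$ denotes the closed ball, and for $\lambda>0$, $\lambda X$ denotes $X$ with metric $\lambda d_X$. For nonempty sets $A,B$ in a metric space $Z$, $\mathrm{ex}(A,B)=\sup_{a\in A}\inf_{b\in B}d_Z(a,b)$, $\mathrm{ex}(\emptyset,B)=0$, and $\mathrm{D}^{z,r}[A,B]=r^{-1}\max\{\mathrm{ex}(A\cap B_Z(z,r),B),\mathrm{ex}(B\cap B_Z(z,r),A)\}$. Put $H^z[A,B]=\inf\{\epsilon\in(0,1]:\mathrm{D}^{z,1/\epsilon}[A,B]\le\epsilon^2\}$ (equal to $1$ if no such $\epsilon$). For pointed metric spaces define $$d_{\mathrm{pGH}}((X,x),(Y,y))=\inf_{\iota_1,\iota_2}H^z[\iota_1(X),\iota_2(Y)],\qquad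 \mathrm{D}^r_{\mathrm{GH}}[(X,x),(Y,y)]=\inf_{\iota_1,\iota_2}\mathrm{D}^{z,r}[\iota_1(X),\iota_2(Y)],$$ the infima being over isometric embeddings $\iota_1:(X,x)\to(Z,z)$, $\iota_2:(Y,y)\to(Z,z)$ (with $\iota_1(x)=z=\iota_2(y)$) into a common pointed metric space $(Z,z)$. $\mathrm{Tan}_{\mathrm{GH}}(X,x)$ is the set of pointed isometry classes of complete pointed metric spaces $(Y,y)$ such that $d_{\mathrm{pGH}}((r_i^{-1}X,x),(Y,y))\to0$ for some sequence of positive numbers $r_i\to0$. A complete pointed metric space $(Y,y)$ is an approximate $s$-tangent of $X$ at $x$ if there are a sequence of positive numbers $r_i\to0$ and sets $X_{x,r_i}\subset X$ with $x\in X_{x,r_i}$ such that for every $R>0$ $$\lim_{i\to\infty}\frac{\mathcal{H}^s(B_X(x,Rr_i)\setminus X_{x,r_i})}{(2Rr_i)^s}=0\quad\text{and}\quad\lim_{i\to\infty}\mathrm{D}^R_{\mathrm{GH}}[(r_i^{-1}X_{x,r_i},x),(Y,y)]=0.$$ If this holds for every sequence $r_i\to0$ of positive numbers, $(Y,y)$ is a strong approximate $s$-tangent of $X$ at $x$. $\mathrm{AppTan}_{\mathrm{GH}}(X,x,s)$ is the set of pointed isometry classes of all approximate $s$-tangents at $x$. *)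

(* Defs.v *)
From HB Require Import structures.
From mathcomp Require Import all_boot all_order all_algebra.
From mathcomp Require Import all_classical all_reals all_analysis.

Set Implicit Arguments.
Unset Strict Implicit.
Unset Printing Implicit Defensive.

Import Order.TTheory GRing.Theory Num.Theory.
Import numFieldNormedType.Exports.

Local Open Scope classical_set_scope.
Local Open Scope ring_scope.

Section balls_and_measure.
Context {R : realType} {X : metricType R}.
Local Open Scope ereal_scope.

(* This is {y | d(x,y) <= r}; the library's [closed_ball] is the topological
   closure of the open ball, which can be smaller. *)
Definition cball (x : X) (r : R) : set X := [set y | (mdist x y <= r)%R].

(* [ereal_sup set0] is -oo, and [maxe 0] turns this into diam set0 = 0. *)
Definition diam (A : set X) : \bar R :=
  maxe 0 (ereal_sup [set (mdist p.1 p.2)%:E | p in A `*` A]).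

(* A finite cover is a sequence padded with empty sets, for which
   diam set0 `^ s = 0 when s > 0. *)
Definition hausdorff_content (s delta : R) (A : set X) : \bar R :=
  ereal_inf [set \sum_(i <oo) diam (U i) `^ s | U in
    [set U : nat -> set X | A `<=` \bigcup_i U i /\
                            forall i, diam (U i) <= delta%:E]].

Definition hausdorff_measure (s : R) (A : set X) : \bar R :=
  lim (hausdorff_content s delta A @[delta --> 0%R^'+]).

Definition hausdorff_ae (s : R) (P : X -> Prop) : Prop :=
  hausdorff_measure s [set x | ~ P x] = 0.

(* A ball is given by its centre and radius. *)
Definition finite_packing_content (s : R) : Prop :=
  exists2 M : R, (0 < M)%R &
  forall B : set (X * R), countable B ->
    (forall b, B b -> (0 < b.2)%R /\ b.2%:E <= diam [set: X]) ->
    trivIset B (fun b => cball b.1 b.2) ->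
    \esum_(b in B) (b.2 `^ s)%:E < M%:E.

End balls_and_measure.

Arguments finite_packing_content {R} X s.

Section excess.
Context {R : realType} {Z : metricType R}.
Local Open Scope ereal_scope.

(* [maxe 0] gives excess set0 B = 0. *)
Definition excess (A B : set Z) : \bar R :=
  maxe 0 (ereal_sup
    [set ereal_inf [set (mdist a b)%:E | b in B] | a in A]).

Definition excess_dist (z : Z) (r : R) (A B : set Z) : \bar R :=
  r^-1%:E * maxe (excess (A `&` cball z r) B) (excess (B `&` cball z r) A).

Definition pointed_dist (z : Z) (A B : set Z) : \bar R :=
  let S := [set e : R | (0 < e <= 1)%R /\
                        excess_dist z e^-1 A B <= (e ^+ 2)%:E] in
  if S == set0 then 1 else ereal_inf [set e%:E | e in S].

End excess.

Definition scaled {R : realType} (l : {posnum R}) (X : metricType R) : Type := X.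

Section scaled_metric.
Context {R : realType} (l : {posnum R}) (X : metricType R).

Definition scaled_dist (x y : scaled l X) : R := l%:num * @mdist R X x y.

Fact scaled_distxx x : scaled_dist x x = 0.
Proof. by rewrite /scaled_dist mdistxx mulr0. Qed.

Fact scaled_dist_positivity x y : scaled_dist x y = 0 -> x = y.
Proof.
move=> /eqP; rewrite mulf_eq0 gt_eqF//= => /eqP.
exact: (@mdist_positivity R X).
Qed.

Fact scaled_dist_sym x y : scaled_dist x y = scaled_dist y x.
Proof. by rewrite /scaled_dist metric_sym. Qed.

Fact scaled_dist_triangle y x z :
  scaled_dist x z <= scaled_dist x y + scaled_dist y z.
Proof. by rewrite /scaled_dist -mulrDr ler_pM2l// metric_triangle. Qed.

HB.instance Definition _ := Choice.copy (scaled l X) X.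
HB.instance Definition _ := isMetric.Build R (scaled l X)
  scaled_distxx scaled_dist_positivity scaled_dist_sym scaled_dist_triangle.

End scaled_metric.

Section subset_metric.
Context {R : realType} {X : metricType R} (A : set X).

Definition set_type_dist (a b : A) : R := mdist (set_val a) (set_val b).

Fact set_type_dist_ge0 a b : 0 <= set_type_dist a b.
Proof. exact: mdist_ge0. Qed.

Fact set_type_dist_positivity a b : set_type_dist a b = 0 -> a = b.
Proof. by move=> /mdist_positivity; exact: val_inj. Qed.

Fact set_type_ballE a d : ball a d = [set b | set_type_dist a b < d].
Proof.
exact: (congr1 (fun B => set_val @^-1` B) (ballEmdist (set_val a) d)).
Qed.

HB.instance Definition _ := PseudoMetric_isMetric.Build R (set_type A)
  set_type_dist_ge0 set_type_dist_positivity set_type_ballE.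

End subset_metric.

Record pmetric (R : realType) := PMetric {
  pm_space :> metricType R;
  pm_point : pm_space }.

Definition scaled_pt {R : realType} (l : {posnum R}) (X : pmetric R) :
    pmetric R :=
  @PMetric R (scaled l X) (pm_point X).

Definition subset_pt {R : realType} {X : metricType R} (A : set X) (x : X)
    (Ax : A x) : pmetric R :=
  @PMetric R (set_type A) (SigSub (mem_set Ax)).

Section gromov_hausdorff.
Context {R : realType}.
Implicit Types X Y Z : pmetric R.

Definition complete_metric (Y : metricType R) : Prop :=
  forall F : set_system Y, ProperFilter F -> cauchy F -> exists l : Y, F --> l.

Definition isometric_embedding (X Y : metricType R) (f : X -> Y) : Prop :=
  forall a b, mdist (f a) (f b) = mdist a b.

Definition pointed_embedding X Z (f : X -> Z) : Prop :=
  isometric_embedding f /\ f (pm_point X) = pm_point Z.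

Definition pointed_isometric X Y : Prop :=
  exists f : X -> Y, pointed_embedding f /\ bijective f.

(* [pmetric R] is too large for the universe of [set], hence the plain
   predicates for classes and for collections of classes. *)
Definition pclass : Type := pmetric R -> Prop.

Definition pointed_class Y : pclass := fun W => pointed_isometric W Y.

Definition dpGH X Y : \bar R :=
  ereal_inf [set d | exists Z (f : X -> Z) (g : Y -> Z),
    [/\ pointed_embedding f, pointed_embedding g &
        d = pointed_dist (pm_point Z) (range f) (range g)]].

Definition DGH (r : R) X Y : \bar R :=
  ereal_inf [set d | exists Z (f : X -> Z) (g : Y -> Z),
    [/\ pointed_embedding f, pointed_embedding g &
        d = excess_dist (pm_point Z) r (range f) (range g)]].

End gromov_hausdorff.

Arguments pclass : clear implicits.

Section tangents.
Context {R : realType} (X : metricType R).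
Implicit Types (x : X) (s : R) (Y : pmetric R) (r : nat -> {posnum R}).

Definition scales_to0 r : Prop := (r i)%:num @[i --> \oo] --> (0 : R).

Definition TanGH x : pclass R -> Prop := fun C =>
  exists Y, [/\ C = pointed_class Y, complete_metric Y &
    exists r, scales_to0 r /\
      dpGH (scaled_pt ((r i)%:num^-1%:pos) (PMetric x)) Y @[i --> \oo]
        --> 0%E].

Definition app_tangent_along s x Y r : Prop :=
  exists (A : nat -> set X) (Ax : forall i, A i x),
  forall rho : R, 0 < rho ->
    (hausdorff_measure s (cball x (rho * (r i)%:num) `\` A i) *
       ((2 * rho * (r i)%:num) `^ s)^-1%:E)%E @[i --> \oo] --> 0%E /\
    DGH rho (scaled_pt ((r i)%:num^-1%:pos) (subset_pt (Ax i))) Y @[i --> \oo]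
      --> 0%E.

Definition app_tangent s x Y : Prop :=
  complete_metric Y /\ exists r, scales_to0 r /\ app_tangent_along s x Y r.

Definition strong_app_tangent s x Y : Prop :=
  complete_metric Y /\ forall r, scales_to0 r -> app_tangent_along s x Y r.

Definition AppTanGH x s : pclass R -> Prop := fun C =>
  exists Y, C = pointed_class Y /\ app_tangent s x Y.

End tangents.

(* Main.v *)
(* Call [x] thin if some balls of radius comparable to [r], at distance comparable to
   [r] from [x], have measure [o(r^s)] along some radii [r -> 0], and crowded if
   the rescaled balls around [x] contain arbitrarily many uniformly separated
   points. A Vitali covering by disjoint balls has bounded sum of [r^s]: for thin
   points the covering balls carry only a small multiple of this sum, and for
   crowded points each of them can be replaced by many disjoint balls of
   comparable radius, so that the sum itself is small. Hence both kinds of points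
   form null sets.
   At a point that is not thin, a set missing only a negligible part of [X] comes
   within [o(r)] of every point at scale [r], so it has the same
   Gromov-Hausdorff limits as [X]. At a point that is not crowded, bounded subsets
   of tangents are totally bounded, so complete tangents at vanishing distance
   from each other are isometric. *)

Require Import Defs.
From HB Require Import structures.
From mathcomp Require Import all_boot all_order all_algebra finmap.
From mathcomp Require Import all_classical all_reals all_analysis.
From mathcomp Require Import ring lra.

Set Implicit Arguments.
Unset Strict Implicit.
Unset Printing Implicit Defensive.

Import Order.TTheory GRing.Theory Num.Theory.
Import numFieldNormedType.Exports.

Local Open Scope classical_set_scope.
Local Open Scope ring_scope.
Local Open Scope quotient_scope.

(** * Hausdorff content and measure *)

Lemma countable_family (R : realType) (X : Type) (T : choiceType) (D : set T)
    (U : T -> set X) : countable D ->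
  exists V : nat -> set X,
    [/\ \bigcup_(i in D) U i `<=` \bigcup_n V n,
        forall n, V n = set0 \/ exists2 i, D i & V n = U i &
        forall mu : set X -> \bar R, mu set0 = 0%E -> (forall A, 0 <= mu A)%E ->
          (\sum_(n <oo) mu (V n) = \esum_(i in D) mu (U i))%E].
Proof.
move=> /countable_injP[e /= einj].
pose V n := \bigcup_(i in [set i | D i /\ e i = n]) U i.
have Ve i : D i -> V (e i) = U i.
  move=> Di; apply/seteqP; split=> [x [j [Dj eji]]|x Uix]; last by exists i.
  by rewrite (einj j i) ?inE.
have V0 n : ~ (e @` D) n -> V n = set0.
  by move=> nD; rewrite -subset0 => x [i [Di ein]] _; apply: nD; exists i.
exists V; split.
- by move=> x [i Di Uix]; exists (e i) => //; exists i.
- move=> n; have [[i Di <-]|nD] := pselect ((e @` D) n).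
    by right; exists i => //; exact: Ve.
  by left; exact: V0.
- move=> mu mu0 mu_ge0; rewrite nneseries_esumT//.
  rewrite (_ : \esum_(i in D) _ = \esum_(i in D) mu (V (e i)))%E; last first.
    by apply: eq_esum => i Di; rewrite Ve.
  rewrite -(esum_image D e (mu \o V)) // [RHS]esum_mkcond.
  apply: eq_esum => n _ /=; case: ifPn => //.
  by move=> /negP; rewrite inE => /V0 ->.
Qed.

Section hausdorff_content.
Context {R : realType} {X : metricType R}.
Implicit Types (s d : R) (A : set X).
Local Open Scope ereal_scope.

Lemma diam_ge0 A : 0 <= diam A. Proof. by rewrite le_max lexx. Qed.

Lemma diam0 : diam (@set0 X) = 0.
Proof.
rewrite /diam set0X image_set0 ereal_sup0; exact: max_l.
Qed.

Lemma diam_leP A (D : \bar R) : 0 <= D ->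
  (forall x y, A x -> A y -> (mdist x y)%:E <= D) -> diam A <= D.
Proof.
move=> D0 AD; rewrite /diam ge_max D0 /=.
by apply: ge_ereal_sup => _ [[x y] [/= Ax Ay] <-]; exact: AD.
Qed.

Lemma diam_cball (x : X) (r : R) : (0 <= r)%R -> diam (cball x r) <= (2 * r)%:E.
Proof.
move=> r0; apply: diam_leP; first by rewrite lee_fin mulr_ge0.
move=> y z /= xy xz; rewrite lee_fin (le_trans (metric_triangle _ x _))//.
by move: xy xz; rewrite /cball/= (metric_sym y); lra.
Qed.

Lemma hausdorff_content_ge0 s d A : 0 <= hausdorff_content s d A.
Proof.
apply: le_ereal_inf_tmp => _ [U _ <-]; apply: nneseries_ge0 => n _ _.
exact: poweR_ge0.
Qed.

Lemma hausdorff_content_le_esum (T : choiceType) (D : set T) (U : T -> set X)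
    s d A :
  (0 < s)%R -> (0 <= d)%R -> countable D -> A `<=` \bigcup_(i in D) U i ->
  (forall i, D i -> diam (U i) <= d%:E) ->
  hausdorff_content s d A <= \esum_(i in D) diam (U i) `^ s.
Proof.
move=> s0 d0 Dc AU Ud; have [V [UV VU VE]] := @countable_family R _ _ _  U Dc.
rewrite -(VE (fun A => diam A `^ s)); last 2 first.
- by rewrite diam0 poweR_EFin powR0// gt_eqF.
- by move=> B; exact: poweR_ge0.
apply: ereal_inf_lbound; exists V => //; split.
  exact: subset_trans AU UV.
by move=> n; have [->|[i Di ->]] := VU n; [rewrite diam0 lee_fin|exact: Ud].
Qed.

Lemma hausdorff_content0 s d : (0 < s)%R -> (0 <= d)%R ->
  hausdorff_content s d (@set0 X) = 0.
Proof.
move=> s0 d0; apply/eqP; rewrite eq_le hausdorff_content_ge0 andbT.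
have := @hausdorff_content_le_esum nat set0 (fun=> set0) s d set0 s0 d0.
by rewrite esum_set0; apply => //; exact: countable0.
Qed.

Lemma hausdorff_content_le_diam s d A : (0 < s)%R -> (0 <= d)%R ->
  diam A <= d%:E -> hausdorff_content s d A <= diam A `^ s.
Proof.
move=> s0 d0 Ad.
have := @hausdorff_content_le_esum unit [set tt] (fun=> A) s d A s0 d0.
rewrite esum_set1 ?poweR_ge0//; apply => //.
by rewrite bigcup_set1.
Qed.

Lemma hausdorff_content_cball s d (x : X) (r : R) : (0 < s)%R -> (0 <= r)%R ->
  (2 * r <= d)%R -> hausdorff_content s d (cball x r) <= ((2 * r) `^ s)%:E.
Proof.
move=> s0 r0 rd; have r20 : (0 <= 2 * r)%R by rewrite mulr_ge0.
have dr := diam_cball x r0.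
apply: (le_trans (hausdorff_content_le_diam s0 (le_trans r20 rd) _)).
  by rewrite (le_trans dr)// lee_fin.
rewrite -poweR_EFin; apply: (gt0_ler_poweR (ltW s0)) => //.
  by rewrite in_itv/= leey andbT diam_ge0.
by rewrite in_itv/= leey andbT lee_fin.
Qed.

Lemma le_hausdorff_content s d A B : A `<=` B ->
  hausdorff_content s d A <= hausdorff_content s d B.
Proof.
move=> AB; apply: le_ereal_inf => _ [U [BU Ud] <-]; exists U => //; split=> //.
exact: subset_trans AB BU.
Qed.

Lemma hausdorff_content_anti s d d' A : (d <= d')%R ->
  hausdorff_content s d' A <= hausdorff_content s d A.
Proof.
move=> dd'; apply: le_ereal_inf => _ [U [BU Ud] <-]; exists U => //; split=> //.
by move=> i; rewrite (le_trans (Ud i))// lee_fin.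
Qed.

Lemma hausdorff_content_bigcup_nat s d (A : nat -> set X) :
  (0 < s)%R -> (0 <= d)%R ->
  hausdorff_content s d (\bigcup_n A n) <=
    \sum_(n <oo) hausdorff_content s d (A n).
Proof.
move=> s0 d0; set h := hausdorff_content s d.
have h0 n : 0 <= h (A n) by exact: hausdorff_content_ge0.
(* An infinite term makes the sum infinite; otherwise all contents are finite and nearly optimal
   covers exist, with errors [e / 2 ^ n.+1]. *)
have [[i hi]|hfin] := pselect (exists i, h (A i) = +oo).
  rewrite (eseries_pinfty _ _ hi) ?leey// => n _.
  by rewrite gt_eqF// (lt_le_trans _ (h0 n)).
apply/lee_addgt0Pr => e e0.
rewrite (le_trans _ (epsilon_trick _ _ (ltW e0)))//.
have /choice[U PU] n : exists U : nat -> set X,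
    [/\ A n `<=` \bigcup_i U i, forall i, diam (U i) <= d%:E &
      \sum_(i <oo) diam (U i) `^ s <= h (A n) + (e / (2 ^ n.+1)%:R)%:E].
  have en : (0 < e / (2 ^ n.+1)%:R)%R by rewrite divr_gt0.
  have hn : h (A n) \is a fin_num.
    by rewrite ge0_fin_numE// ltey; apply/eqP => hn; apply: hfin; exists n.
  have [_ [U [AU Ud] <-] Ue] := lb_ereal_inf_adherent en hn.
  by exists U; split => //; exact: ltW.
have := @hausdorff_content_le_esum (nat * nat)%type setT
  (fun p => U p.1 p.2) s d (\bigcup_n A n) s0 d0.
move=> /(_ (countableP _)) H; apply: (le_trans (H _ _)).
- move=> x [n _ Anx]; have [+ _ _] := PU n.
  by move=> /(_ _ Anx)[i _ Uix]; exists (n, i).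
- by move=> [n i] _; have [_ + _] := PU n.
rewrite (_ : [set: nat * nat] = [set: nat] `*`` fun=> [set: nat]); last first.
  by apply/seteqP; split.
rewrite -(@esum_esum _ _ _ _ _ (fun n i => diam (U n i) `^ s)); last first.
  by move=> *; exact: poweR_ge0.
rewrite nneseries_esumT; last first.
  by move=> n; rewrite adde_ge0// lee_fin divr_ge0// ltW.
apply: le_esum => n _; rewrite -nneseries_esumT; last first.
  by move=> *; exact: poweR_ge0.
by have [] := PU n.
Qed.

Lemma hausdorff_content_bigcup (T : choiceType) (D : set T) (A : T -> set X)
    s d : (0 < s)%R -> (0 <= d)%R -> countable D ->
  hausdorff_content s d (\bigcup_(i in D) A i) <=
    \esum_(i in D) hausdorff_content s d (A i).
Proof.
move=> s0 d0 Dc; have [V [AV _ VE]] := @countable_family R _ _ _  A Dc.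
rewrite -(VE (hausdorff_content s d)); last 2 first.
- exact: hausdorff_content0.
- by move=> B; exact: hausdorff_content_ge0.
apply: le_trans (le_hausdorff_content _ _ AV) _.
exact: hausdorff_content_bigcup_nat.
Qed.

(** The content does not increase with [d], so its limit at 0 from the right is a supremum. *)
Lemma hausdorff_measureE s A : hausdorff_measure s A =
  ereal_sup [set hausdorff_content s d A | d in [set d | (0 < d)%R]].
Proof.
apply: cvg_lim => //.
rewrite (_ : [set d | (0 < d)%R] = [set` `]0%R, +oo[]); last first.
  by apply/seteqP; split => x /=; rewrite in_itv/= andbT.
apply: (nonincreasing_at_right_cvge +oo%O) => //.
by move=> d d' _ _; exact: hausdorff_content_anti.
Qed.

Lemma hausdorff_content_le_measure s d A : (0 < d)%R ->
  hausdorff_content s d A <= hausdorff_measure s A.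
Proof.
by move=> d0; rewrite hausdorff_measureE; apply: ereal_sup_ubound; exists d.
Qed.

Lemma le_hausdorff_measure s A B : A `<=` B ->
  hausdorff_measure s A <= hausdorff_measure s B.
Proof.
move=> AB; rewrite [leLHS]hausdorff_measureE; apply: ge_ereal_sup => _ [d d0 <-].
apply: le_trans (hausdorff_content_le_measure s B d0).
exact: le_hausdorff_content.
Qed.

Lemma hausdorff_measure_eq0 s A :
  (forall d, (0 < d)%R -> hausdorff_content s d A = 0) ->
  hausdorff_measure s A = 0.
Proof.
move=> A0; apply/eqP; rewrite eq_le -{2}(A0 1%R)// hausdorff_content_le_measure//.
rewrite andbT hausdorff_measureE.
by apply: ge_ereal_sup => _ [d d0 <-]; rewrite A0.
Qed.

Lemma hausdorff_measure0 s : (0 < s)%R -> hausdorff_measure s (@set0 X) = 0.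
Proof.
move=> s0; apply: hausdorff_measure_eq0 => d d0.
by rewrite hausdorff_content0// ltW.
Qed.

End hausdorff_content.

(** * A Vitali covering argument from the packing bound *)

Section ball_packing.
Context {R : realType} {X : metricType R}.
Implicit Types (b : X * R) (l : seq (X * R)) (s M c K d eta : R).

(** In a general metric space this is stronger than disjointness. It depends only on centres and
    radii, and is inherited by balls [b'] inside [b] in the sense that
    [mdist b.1 b'.1 + b'.2 <= b.2]. *)
Definition sep_balls : rel (X * R) := fun b b' => b.2 + b'.2 < mdist b.1 b'.1.

Lemma sep_balls_sym : symmetric sep_balls.
Proof. by move=> b b'; rewrite /sep_balls addrC metric_sym. Qed.

Lemma sep_balls_disjoint b b' : sep_balls b b' ->
  cball b.1 b.2 `&` cball b'.1 b'.2 = set0.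
Proof.
move=> sbb'; rewrite -subset0 => x [] /=; rewrite /cball/= => bx b'x.
have := le_lt_trans (metric_triangle b.1 x b'.1) (le_lt_trans _ sbb').
move: sbb'; rewrite /sep_balls => sbb'.
have := metric_triangle b.1 x b'.1; rewrite (metric_sym x).
lra.
Qed.

Lemma pairwise_mem_neq (T : eqType) (r : rel T) (l : seq T) : symmetric r ->
  pairwise r l -> {in l &, forall x y, x != y -> r x y}.
Proof.
move=> rsym rl.
have : all2rel [rel x y | (x == y) || r x y] l.
  rewrite -pairwise_all2rel.
  - by apply: sub_pairwise rl => x y /= ->; rewrite orbT.
  - by move=> x /=; rewrite eqxx.
  - by move=> x y /=; rewrite eq_sym rsym.
by move=> /allrelP H x y xl yl xy; have /= := H _ _ xl yl; rewrite (negPf xy).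
Qed.

Lemma uniq_pairwise_neq (T : eqType) (r : rel T) (l : seq T) : uniq l ->
  {in l &, forall x y, x != y -> r x y} -> pairwise r l.
Proof.
elim: l => //= x l IH /andP[xl /IH {}IH] H; apply/andP; split.
  apply/allP => y yl; apply: H; rewrite ?inE ?eqxx ?yl ?orbT//.
  by apply: contraNneq xl => ->.
by apply: IH => y z yl zl; apply: H; rewrite inE ?yl ?zl orbT.
Qed.

Lemma finite_packing_seq s : finite_packing_content X s ->
  exists2 M, 0 < M & forall l,
    {in l, forall b, 0 < b.2 /\ (b.2%:E <= diam [set: X])%E} ->
    pairwise sep_balls l -> \sum_(b <- l) b.2 `^ s <= M.
Proof.
move=> [M M0 HM]; exists M => // l lr lsep.
(* A repeated ball would be separated from itself, against its positive radius. *)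
have ul : uniq l.
  elim: l lr lsep => //= b l IH lr /andP[/allP bl lsep]; apply/andP; split.
    apply/negP => /bl; rewrite /sep_balls mdistxx.
    by have [|b0 _] := lr b; [rewrite inE eqxx|lra].
  by apply: IH => // b' b'l; apply: lr; rewrite inE b'l orbT.
rewrite -lee_fin; apply: ltW; have := HM [set` l].
rewrite esum_fset; [|exact: finite_seq|by move=> *; rewrite lee_fin powR_ge0].
rewrite -fsbig_seq// sumEFin; apply.
- by apply: finite_set_countable; exact: finite_seq.
- by move=> b /= bl; apply: lr.
- apply/trivIsetP => b b' /= bl b'l bb'; apply: sep_balls_disjoint.
  exact: (pairwise_mem_neq sep_balls_sym lsep).
Qed.

(* A maximal selection among those in which a ball of [F] that meets some
   selected ball meets one of at least half its radius. *)
Lemma vitali_selection (F : set (X * R)) (rho : R) :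
  (forall b, F b -> 0 < b.2 <= rho) ->
  exists D : set (X * R), [/\ D `<=` F,
    forall b b', D b -> D b' -> b != b' -> sep_balls b b' &
    forall b, F b -> exists2 b', D b' & ~~ sep_balls b b' /\ b.2 <= 2 * b'.2].
Proof.
move=> Frho.
(* The last clause constrains only balls not separated from some selected ball, so [P] passes to
   unions of chains. *)
pose P (D : set (X * R)) := [/\ D `<=` F,
  forall b b', D b -> D b' -> b != b' -> sep_balls b b' &
  forall b b', F b -> D b' -> ~~ sep_balls b b' ->
    exists2 b', D b' & ~~ sep_balls b b' /\ b.2 <= 2 * b'.2].
have [C CP Ctot|D [[DF Dsep Dcov] Dmax]] := @Zorn_bigcup _ P.
  split.
  - by move=> b [D /CP[DF _ _] /DF].
  - move=> b b' [D CD Db] [D' CD' D'b'].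
    have [/(_ _ Db) D'b|/(_ _ D'b') Db'] := Ctot _ _ CD CD'.
      by have [_ + _] := CP _ CD'; exact.
    by have [_ + _] := CP _ CD; exact.
  - move=> b b' Fb [D CD Db'] bb'; have [_ _ /(_ _ _ Fb Db' bb')] := CP _ CD.
    by move=> [b'' Db'' ?]; exists b'' => //; exists D.
exists D; split => // b Fb; apply: contrapT => nb.
have bG b' : D b' -> sep_balls b b'.
  move=> Db'; apply: contrapT => /negP sbb'.
  by apply: nb; exact: Dcov Fb Db' sbb'.
pose G := [set b | F b /\ forall b', D b' -> sep_balls b b'].
pose S := [set b.2 | b in G].
have Gb : G b by [].
have supS : has_sup S.
  split; first by exists b.2, b.
  by exists rho => _ [b1 [/Frho/andP[_ +] _] <-].
have Sle b1 : G b1 -> b1.2 <= sup S.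
  by move=> ?; apply: ub_le_sup; [exact: supS.2|exists b1].
have supS0 : 0 < sup S by rewrite (lt_le_trans _ (Sle _ Gb))//; have /andP[] := Frho _ Fb.
have supS2 : 0 < sup S / 2 by rewrite divr_gt0.
(* The radius of [b0] exceeds half of every radius in [G], so adding [b0] to [D] preserves [P],
   against maximality. *)
have [_ [b0 [Fb0 Gb0] <-] b0S] := sup_adherent supS2 supS.
have /andP[b00 _] := Frho _ Fb0.
apply: (Dmax (D `|` [set b0])).
  split; first by move=> b1; left.
  move=> /(_ b0 (or_intror erefl)) /Gb0.
  rewrite /sep_balls mdistxx; lra.
split.
- by move=> b1 [/DF//|->].
- move=> b1 b2 [Db1|->] [Db2|->]; rewrite ?eqxx//.
  + exact: Dsep.
  + by move=> _; rewrite sep_balls_sym; exact: Gb0.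
  + by move=> _; exact: Gb0.
- move=> b1 b2 Fb1 Db2 sb12.
  have [[b3 Db3 sb13]|nb1] := pselect (exists2 b3, D b3 & ~~ sep_balls b1 b3).
    by have [b4 Db4 ?] := Dcov _ _ Fb1 Db3 sb13; exists b4 => //; left.
  have Gb1 : G b1.
    split=> // b3 Db3; apply: contrapT => /negP sb13.
    by apply: nb1; exists b3.
  exists b0; first by right.
  split; last by have := Sle _ Gb1; lra.
  case: Db2 sb12 => [Db2|-> //] sb12.
  by exfalso; apply: nb1; exists b2.
Qed.

Lemma exists_lower_bound (T : eqType) (l : seq T) (f : T -> R) :
  {in l, forall x, 0 < f x} -> exists2 e, 0 < e & {in l, forall x, e <= f x}.
Proof.
elim: l => [|x l IH] fl; first by exists 1.
have [|e e0 el] := IH; first by move=> y yl; apply: fl; rewrite inE yl orbT.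
exists (Num.min e (f x)).
  by rewrite lt_min e0 fl// inE eqxx.
by move=> y; rewrite inE ge_min => /predU1P[->|/el ->//]; rewrite lexx orbT.
Qed.

Section selection_sums.
Variables (D : set (X * R)) (s M : R).
Hypothesis s0 : 0 < s.
Hypothesis D0 : forall b, D b -> 0 < b.2.
Hypothesis DM : forall l, uniq l -> {in l, forall b, D b} ->
  \sum_(b <- l) b.2 `^ s <= M.

(** For each [n], the bound [M] leaves only finitely many balls of radius above [n.+1%:R^-1]. *)
Lemma countable_packing : countable D.
Proof.
rewrite (_ : D = \bigcup_n [set b | D b /\ n.+1%:R^-1 < b.2]); last first.
  apply/seteqP; split=> [b Db|b [n _ []//]].
  exists (Num.truncn b.2^-1) => //; split=> //.
  have b0 := D0 Db.
  by rewrite invf_plt ?posrE// truncnS_gt.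
apply: bigcup_countable => // n _; apply: finite_set_countable.
apply: contrapT => /(infinite_set_fset (Num.truncn (M / n.+1%:R^-1 `^ s)).+1)[B BD].
apply/negP; rewrite -ltnNge.
have e0 : 0 < n.+1%:R^-1 `^ s :> R by rewrite powR_gt0.
have BM : \sum_(b <- B) n.+1%:R^-1 `^ s <= M.
  apply: le_trans (@DM B (fset_uniq B) _); last by move=> b /BD[].
  rewrite big_seq [leRHS]big_seq; apply: ler_sum => b /BD[Db nb].
  by apply: ge0_ler_powR; rewrite ?nnegrE ?ltW// D0.
rewrite -(ltr_nat R) (le_lt_trans _ (truncnS_gt _))// ler_pdivlMr//.
by move: BM; rewrite big_const_seq count_predT iter_addr_0 mulr_natl.
Qed.

(** Take [l0] whose sum is within [e] of the supremum of all finite sums: a list disjoint from it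
    can add at most [e]. *)
Lemma packing_tail (e : R) : 0 < e ->
  exists2 l0 : seq (X * R), {in l0, forall b, D b} & forall l, uniq l ->
    {in l, forall b, D b /\ b \notin l0} -> \sum_(b <- l) b.2 `^ s <= e.
Proof.
move=> e0.
pose S := [set \sum_(b <- l) b.2 `^ s | l in
             [set l | uniq l /\ {in l, forall b, D b}]].
have supS : has_sup S.
  split; first by exists 0, [::]; rewrite ?big_nil.
  by exists M => _ [l [ul lD] <-]; exact: DM.
have [_ [l0 [ul0 l0D] <-] l0S] := sup_adherent e0 supS.
exists l0 => // l ul lD.
have : \sum_(b <- l0 ++ l) b.2 `^ s <= sup S.
  apply: ub_le_sup; first exact: supS.2.
  exists (l0 ++ l) => //; split.
    rewrite cat_uniq ul0 ul/= andbT.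
    by apply/hasPn => b /lD[].
  by move=> b; rewrite mem_cat => /orP[/l0D//|/lD[]].
rewrite big_cat/=; lra.
Qed.

End selection_sums.

(* The selected balls outside a finite list [l0] have small total size, so their
   enlargements cover the part of [E] missed by [l0] at small cost; no
   measurability is needed. *)
Lemma hausdorff_content_vitali (F : set (X * R)) (E : set X) s d M c K :
  0 < s -> 0 <= d -> 0 <= c -> 0 <= K ->
  (forall b, F b -> 0 < b.2 /\ 2 * (2 * K + 3) * b.2 <= d) ->
  (forall l, {in l, forall b, F b} -> pairwise sep_balls l ->
    \sum_(b <- l) b.2 `^ s <= M) ->
  (forall x eta, E x -> 0 < eta ->
    exists2 b, F b & b.2 < eta /\ mdist x b.1 <= K * b.2) ->
  (forall b, F b ->
    hausdorff_content s d (cball b.1 b.2) <= (c * b.2 `^ s)%:E)%E ->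
  (hausdorff_content s d E <= (c * M)%:E)%E.
Proof.
move=> s0 d0 c0 K0 Fr FM Efine Fc.
have F0 b : F b -> 0 < b.2 by move=> /Fr[].
(* A point within [K * b.2] of [b.1], where [b] is not separated from [b'] and [b.2 <= 2 * b'.2], is
   within [(K + 1) * b.2 + b'.2 <= L * b'.2] of [b'.1]. *)
pose L : R := 2 * K + 3.
have L0 : 0 < L by rewrite /L; lra.
have Frd b : F b -> 0 < b.2 <= d.
  by move=> /Fr[b0 bd]; rewrite b0/=; nra.
have [D [DF Dsep Dcov]] := vitali_selection Frd.
have D0 b : D b -> 0 < b.2 by move=> /DF/F0.
have DM l : uniq l -> {in l, forall b, D b} -> \sum_(b <- l) b.2 `^ s <= M.
  move=> ul lD; apply: FM => [b /lD/DF//|].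
  by apply: uniq_pairwise_neq => // b b' /lD Db /lD Db'; exact: Dsep.
apply/lee_addgt0Pr => tau tau0.
have Ls0 : 0 < (2 * L) `^ s by rewrite powR_gt0// mulr_gt0.
(* An enlarged ball costs at most [(2 * L) ^ s] times the power of its original radius, hence the
   divisor. *)
have [l0 l0D l0tail] := packing_tail DM (divr_gt0 tau0 Ls0).
pose A b := if b \in l0 then cball b.1 b.2 else cball b.1 (L * b.2).
have EA : E `<=` \bigcup_(b in D) A b.
  move=> x Ex; have [[b bl0 bx]|nb] := pselect (exists2 b, b \in l0 &
      mdist b.1 x <= b.2).
    by exists b; [exact: l0D|rewrite /A bl0].
  (* The point [x] is outside the finitely many closed balls of [l0], with a margin [e]. A ball of
     [F] near [x] of radius below [e / (K + 1)] is separated from all of them, so the selected ball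
     [b'] is not in [l0]. *)
  have [|e e0 el0] := @exists_lower_bound _ l0 (fun b => mdist b.1 x - b.2).
    move=> b bl0; rewrite subr_gt0 ltNge; apply/negP => bx.
    by apply: nb; exists b.
  have K1 : 0 < K + 1 by lra.
  have [b Fb [be xb]] := Efine x _ Ex (divr_gt0 e0 K1).
  move: be; rewrite ltr_pdivlMr// => be.
  have [b' Db' [/negP/negP]] := Dcov _ Fb.
  rewrite /sep_balls -leNgt => bb' b2b'.
  have tri := metric_triangle b'.1 b.1 x.
  rewrite (metric_sym b'.1 b.1) (metric_sym b.1 x) in tri.
  exists b' => //; rewrite /A; case: ifPn => b'l0; rewrite /cball/=.
    by have := el0 _ b'l0; nra.
  by rewrite /L; nra.
apply: le_trans (le_hausdorff_content _ _ EA) _.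
apply: le_trans (hausdorff_content_bigcup _ s0 d0 (countable_packing s0 D0 DM)) _.
pose a b := if b \in l0 then c * b.2 `^ s else (2 * L) `^ s * b.2 `^ s.
apply: (@le_trans _ _ (\esum_(b in D) (a b)%:E)%E).
  apply: le_esum => b Db; rewrite /A /a; case: ifPn => _; first exact/Fc/DF.
  have [b0 bd] := Fr _ (DF _ Db).
  have Lb0 : 0 <= L * b.2 by rewrite mulr_ge0 ?ltW.
  rewrite -powRM ?(ltW b0)//; last by rewrite mulr_ge0 ?(ltW L0).
  by rewrite -mulrA hausdorff_content_cball// mulrA.
apply: ge_ereal_sup => _ [B [Bfin BD] <-].
(* Balls in [l0] contribute at most [c * M] by the packing bound, the others at most [tau]. *)
rewrite fsbig_finite// sumEFin lee_fin (bigID (mem l0))/=; apply: lerD.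
  rewrite -big_filter (eq_big_seq (fun b => c * b.2 `^ s)); last first.
    by move=> b; rewrite mem_filter /a => /andP[->].
  rewrite -mulr_sumr ler_wpM2l//; apply: DM; first by rewrite filter_uniq// fset_uniq.
  by move=> b; rewrite mem_filter in_fset_set// => /andP[_ /set_mem/BD].
rewrite -big_filter (eq_big_seq (fun b => (2 * L) `^ s * b.2 `^ s)); last first.
  by move=> b; rewrite mem_filter /a => /andP[/negPf ->].
rewrite -mulr_sumr -ler_pdivlMl// mulrC; apply: l0tail.
  by rewrite filter_uniq// fset_uniq.
by move=> b; rewrite mem_filter in_fset_set// => /andP[? /set_mem/BD].
Qed.

End ball_packing.

(** * Null sets of thin and crowded points *)

Section bad_points.
Context {R : realType} {X : metricType R}.
Implicit Types (b : X * R) (L : seq (X * R)) (l : seq X) (s M c K d rho eta : R).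

(** Here and in [crowded_at], one parameter [K] controls all comparability constants. Both
    conditions weaken as [K > 0] grows, so integer values suffice. *)
Definition thin_at s K (x : X) := forall c eta, 0 < c -> 0 < eta ->
  exists r p, [/\ 0 < r < eta, mdist x p <= K * r &
    (hausdorff_measure s (cball p (r / K)) < (c * r `^ s)%:E)%E].

Definition crowded_at K (x : X) := forall (N : nat) eta, 0 < eta ->
  exists r l, [/\ 0 < r < eta, size l = N,
    {in l, forall p, mdist x p <= K * r} &
    pairwise (fun p q => r / K < mdist p q) l].

Lemma ereal_eq0_le (x : \bar R) M : 0 < M -> (0 <= x)%E ->
  (forall c, 0 < c -> (x <= (c * M)%:E)%E) -> x = 0%E.
Proof.
move=> M0 x0 xM; apply/eqP; rewrite eq_le x0 andbT.
apply/lee_addgt0Pr => e e0; rewrite add0e -[e](divfK (lt0r_neq0 M0)).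
by apply: xM; rewrite divr_gt0.
Qed.

(** Only radii up to the diameter are controlled. If the diameter is 0, the single set [X] is a
    cover of cost 0; otherwise all sufficiently small radii are admissible. *)
Lemma finite_packing_small s : 0 < s -> finite_packing_content X s ->
  (forall d (E : set X), 0 < d -> hausdorff_content s d E = 0%E) \/
  exists M rho, [/\ 0 < M, 0 < rho & forall L,
    {in L, forall b, 0 < b.2 <= rho} -> pairwise sep_balls L ->
    \sum_(b <- L) b.2 `^ s <= M].
Proof.
move=> s0 /finite_packing_seq[M M0 HM].
have [D0|D0] := eqVneq (diam [set: X]) 0%E.
  left=> d E d0; apply/eqP; rewrite eq_le hausdorff_content_ge0 andbT.
  have ET : (hausdorff_content s d E <= hausdorff_content s d [set: X])%E.
    exact: le_hausdorff_content.
  rewrite (le_trans ET)//.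
  have := @hausdorff_content_le_diam _ _ s d [set: X] s0 (ltW d0).
  by rewrite D0 poweR_EFin powR0 ?gt_eqF//; apply; rewrite lee_fin ltW.
right.
have [rho rho0 rhoD] : exists2 rho, 0 < rho & (rho%:E <= diam [set: X])%E.
  have {}D0 : (0 < diam [set: X])%E by rewrite lt0e D0 diam_ge0.
  case: (diam [set: X]) D0 => [r|_|//]; last by exists 1 => //; rewrite leey.
  by rewrite lte_fin => r0; exists r.
exists M, rho; split=> // L Lrho; apply: HM => b /Lrho /andP[-> brho]; split=> //.
by apply: le_trans rhoD; rewrite lee_fin.
Qed.

(** The covering uses the light balls [cball p (r / K)] themselves, giving the bound [c * M] for
    every [c > 0]. *)
Lemma hausdorff_content_thin s K d : 0 < s -> finite_packing_content X s ->
  0 < K -> 0 < d -> hausdorff_content s d [set x | thin_at s K x] = 0%E.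
Proof.
move=> s0 /(finite_packing_small s0)[H0|[M [rho [M0 rho0 HM]]]] K0 d0.
  exact: H0.
apply: (ereal_eq0_le M0 (hausdorff_content_ge0 _ _ _)) => c c0.
(* The distance [K * r] from [x] to the centre is [K * K] times the radius [r / K]. *)
pose C : R := 2 * (2 * (K * K) + 3).
have C0 : 0 < C by rewrite /C; nra.
pose F := [set b : X * R | [/\ 0 < b.2, b.2 <= rho, C * b.2 <= d &
  (hausdorff_content s d (cball b.1 b.2) <= (c * b.2 `^ s)%:E)%E]].
apply: (@hausdorff_content_vitali _ _ F _ _ _ _ _ (K * K)) => //.
- exact: ltW.
- exact: ltW.
- by rewrite mulr_ge0 ?ltW.
- by move=> b [].
- by move=> L LF; apply: HM => b /LF[-> ->].
- move=> x eta /= xthin eta0.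
  pose t := Num.min eta (Num.min rho (d / C)).
  have t0 : 0 < t by rewrite !lt_min eta0 rho0 divr_gt0.
  (* The extra factor converts the power of [r] into that of the radius [r / K]. *)
  have cK : 0 < c * (K^-1) `^ s by rewrite mulr_gt0// powR_gt0// invr_gt0.
  have [r [p [/andP[r0 rt] xp Hp]]] := xthin _ _ cK (mulr_gt0 t0 K0).
  have rK0 : 0 < r / K by rewrite divr_gt0.
  move: rt; rewrite -ltr_pdivrMr// !lt_min => /and3P[r_eta r_rho r_d].
  exists (p, r / K) => /=; last first.
    by split=> //; rewrite (le_trans xp)// mulrCA -mulrA divff ?mulr1 ?gt_eqF// mulrC.
  split => /=; [by []|exact: ltW| |].
    by rewrite mulrC -ler_pdivlMr// ltW.
  apply: le_trans (hausdorff_content_le_measure s _ d0) _.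
  apply/ltW; rewrite (lt_le_trans Hp)// lee_fin -mulrA.
  rewrite -powRM ?invr_ge0 ?(ltW K0) ?(ltW r0)//.
  by rewrite (mulrC K^-1).
- by move=> b [].
Qed.

(** Each ball is replaced by [N] balls of [kappa] times its radius. Those from the same ball are
    separated by the spacing of their centres, those from different balls because they lie inside
    separated balls. *)
Lemma subdivide_packing s (N : nat) (kappa : R) L : 0 < kappa ->
  {in L, forall b, 0 < b.2 /\ exists l, [/\ size l = N,
    {in l, forall p, mdist b.1 p + kappa * b.2 <= b.2} &
    pairwise (fun p q => 2 * (kappa * b.2) < mdist p q) l]} ->
  pairwise sep_balls L ->
  exists L', [/\
    {in L', forall b', exists2 b, b \in L &
       b'.2 = kappa * b.2 /\ mdist b.1 b'.1 + b'.2 <= b.2},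
    pairwise sep_balls L' &
    \sum_(b <- L') b.2 `^ s = N%:R * kappa `^ s * \sum_(b <- L) b.2 `^ s].
Proof.
move=> k0; elim: L => [|b L IH] HL.
  by move=> _; exists [::]; split => //; rewrite !big_nil mulr0.
rewrite /= => /andP[/allP bL /IH[|L' [L'1 L'2 L'3]]].
  by move=> b' b'L; apply: HL; rewrite inE b'L orbT.
have [|b0 [l [sl lb lsep]]] := HL b; first by rewrite inE eqxx.
exists ([seq (p, kappa * b.2) | p <- l] ++ L'); split.
- move=> b'; rewrite mem_cat => /orP[/mapP[p pl ->]|/L'1[b1 b1L ?]].
    by exists b; [rewrite inE eqxx|split=> //; exact: lb].
  by exists b1 => //; rewrite inE b1L orbT.
- rewrite pairwise_cat L'2 andbT; apply/andP; split.
    apply/allrelP => _ b2 /mapP[p pl ->] /L'1[b1 b1L [_ b12]].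
    have := bL _ b1L; rewrite /sep_balls /= => bb1.
    have := lb _ pl.
    have := metric_triangle b.1 p b1.1; have := metric_triangle p b2.1 b1.1.
    rewrite (metric_sym b2.1); lra.
  rewrite pairwise_map; apply: sub_pairwise lsep => p q /=.
  by rewrite /sep_balls/=; lra.
- rewrite big_cat big_map /= L'3 big_cons [RHS]mulrDr; congr (_ + _).
  rewrite big_const_seq count_predT iter_addr_0 sl.
  rewrite powRM ?(ltW k0) ?(ltW b0)//.
  by rewrite -[LHS]mulr_natl mulrA.
Qed.

(** Subdividing a separated family of balls at crowded points multiplies its sum by [N * kappa ^ s]
    while [M] still bounds the result, so the original sum is small. *)
Lemma hausdorff_content_crowded s K d : 0 < s -> finite_packing_content X s ->
  1 <= K -> 0 < d -> hausdorff_content s d [set x : X | crowded_at K x] = 0%E.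
Proof.
move=> s0 /(finite_packing_small s0)[H0|[M [rho [M0 rho0 HM]]]] K1 d0.
  exact: H0.
apply: (ereal_eq0_le M0 (hausdorff_content_ge0 _ _ _)) => c c0.
have K0 : 0 < K by lra.
(* The ball about [x] has radius [2 * K * r], and [kappa] times it is [r / (2 * K)], half of the
   separation [r / K]. *)
pose kappa : R := (2 * K)^-1 / (2 * K).
have kappa0 : 0 < kappa by rewrite divr_gt0 ?invr_gt0 ?mulr_gt0.
have ks0 : 0 < kappa `^ s by rewrite powR_gt0.
(* Large enough that the final bound [2 ^ s * (M / (N * kappa ^ s))] is at most [c * M]. *)
pose N := (Num.truncn (2 `^ s / (kappa `^ s * c))).+1.
have N0 : 0 < N%:R :> R by [].
have Nc : 2 `^ s <= N%:R * kappa `^ s * c.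
  by rewrite -mulrA -ler_pdivrMr ?mulr_gt0// ltW// truncnS_gt.
pose F := [set b : X * R | [/\ 0 < b.2, b.2 <= rho, 6 * b.2 <= d &
  exists l, [/\ size l = N,
    {in l, forall p, mdist b.1 p + kappa * b.2 <= b.2} &
    pairwise (fun p q => 2 * (kappa * b.2) < mdist p q) l]]].
have k1 : kappa <= 1.
  rewrite /kappa -invfM invf_le1; nra.
(* The distance constant is 0 because the balls are centred at the crowded points themselves. *)
have := @hausdorff_content_vitali _ _ F [set x : X | crowded_at K x] s d
  (M / (N%:R * kappa `^ s)) (2 `^ s) 0 s0 (ltW d0) (powR_ge0 _ _) (lexx _).
move=> H; apply: le_trans (H _ _ _ _) _.
- by move=> b [b0 _ bd _]; split=> //; lra.
- move=> L LF Lsep; rewrite ler_pdivlMr ?mulr_gt0// mulrC.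
  have [|L' [L'1 L'2 <-]] := @subdivide_packing s N kappa L kappa0 _ Lsep.
    by move=> b /LF[].
  apply: HM => // b' /L'1[b /LF[b0 brho _ _] [-> _]].
  by rewrite mulr_gt0//=; nra.
- move=> x eta /= xc eta0.
  pose t := Num.min eta (Num.min rho (d / 6)).
  have t0 : 0 < t by rewrite !lt_min eta0 rho0 divr_gt0.
  have K20 : 0 < 2 * K by lra.
  have [r [l [/andP[r0 rt] lN lx lsep]]] := xc N _ (divr_gt0 t0 K20).
  move: rt; rewrite ltr_pdivlMr// mulrC !lt_min => /and3P[r_eta r_rho r_d].
  have kr : kappa * (2 * K * r) = r / K / 2 by rewrite /kappa; field; lra.
  have rK : r / K <= r by rewrite ler_pdivrMr// ler_pMr.
  exists (x, 2 * K * r) => /=; last by rewrite mdistxx mul0r.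
  split=> /=; [by rewrite mulr_gt0|exact: ltW|lra|exists l; split=> //].
    move=> p /lx xp; rewrite kr.
    have : r <= K * r by rewrite ler_pMl.
    by lra.
  by apply: sub_pairwise lsep => p q; rewrite kr; lra.
- move=> b [b0 _ bd _]; rewrite -powRM ?(ltW b0)//.
  by apply: hausdorff_content_cball => //; [exact: ltW|lra].
rewrite lee_fin mulrA ler_pdivrMr ?mulr_gt0// (mulrAC c) (mulrC c) ler_pM2r//.
Qed.

End bad_points.

(** * Gromov-Hausdorff closeness through couplings *)

Section metric_quotient.
Context {R : realType} (S : choiceType) (d : S -> S -> R).
Hypothesis dxx : forall x, d x x = 0.
Hypothesis dsym : forall x y, d x y = d y x.
Hypothesis dtri : forall y x z, d x z <= d x y + d y z.

Let d_ge0 x y : 0 <= d x y.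
Proof. have := dtri y x x; rewrite dxx (dsym y); lra. Qed.

Definition indist (x y : S) := d x y == 0.

Lemma indist_refl : reflexive indist.
Proof. by move=> x; rewrite /indist dxx. Qed.

Lemma indist_sym : symmetric indist.
Proof. by move=> x y; rewrite /indist dsym. Qed.

Lemma indist_trans : transitive indist.
Proof.
move=> y x z /eqP xy /eqP yz; rewrite /indist eq_le d_ge0 andbT.
by rewrite (le_trans (dtri y x z))// xy yz addr0.
Qed.

Definition indist_equiv := EquivRel indist indist_refl indist_sym indist_trans.

Definition metric_quotient := {eq_quot indist_equiv}.

HB.instance Definition _ := Choice.copy metric_quotient {eq_quot indist_equiv}.

Definition quotient_dist (x y : metric_quotient) : R :=
  d (repr (x : {eq_quot indist_equiv})) (repr (y : {eq_quot indist_equiv})).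

Fact quotient_distxx x : quotient_dist x x = 0.
Proof. exact: dxx. Qed.

Fact quotient_dist_sym x y : quotient_dist x y = quotient_dist y x.
Proof. exact: dsym. Qed.

Fact quotient_dist_triangle y x z :
  quotient_dist x z <= quotient_dist x y + quotient_dist y z.
Proof. exact: dtri. Qed.

Fact quotient_dist_positivity x y : quotient_dist x y = 0 -> x = y.
Proof.
move=> xy; rewrite -[x](@reprK _ {eq_quot indist_equiv}).
rewrite -[y](@reprK _ {eq_quot indist_equiv}).
by apply/eqmodP; rewrite /= /indist; apply/eqP.
Qed.

HB.instance Definition _ := isMetric.Build R metric_quotient
  quotient_distxx quotient_dist_positivity quotient_dist_sym
  quotient_dist_triangle.

Definition quotient_class (x : S) : metric_quotient :=
  \pi_({eq_quot indist_equiv}) x.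

(** Points at [d]-distance 0 have equal distances to every point, so the representatives in
    [quotient_dist] do not matter. *)
Lemma mdist_quotient_class x y :
  mdist (quotient_class x) (quotient_class y) = d x y.
Proof.
have repr0 z : d z (repr (\pi_({eq_quot indist_equiv}) z)) = 0.
  by have /eqmodP/eqP := esym (reprK (\pi_({eq_quot indist_equiv}) z)).
rewrite /mdist /= /quotient_dist /quotient_class.
set x' := repr _; set y' := repr _.
have xx' : d x x' = 0 by exact: repr0.
have yy' : d y y' = 0 by exact: repr0.
apply/eqP; rewrite eq_le; apply/andP; split.
  by have := dtri x x' y'; have := dtri y x y'; rewrite (dsym x' x); lra.
by have := dtri x' x y; have := dtri y' x' y; rewrite (dsym y' y); lra.
Qed.

End metric_quotient.

Section couplings.
Context {R : realType}.
Implicit Types P Q T Z : pmetric R.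

(* [c p q] plays the role of the distance from [p] to [q] in a common pointed
   space containing isometric copies of [P] and [Q]. *)
Definition coupling P Q (c : P -> Q -> R) : Prop :=
  [/\ c (pm_point P) (pm_point Q) = 0,
      forall p p' q, c p q <= mdist p p' + c p' q,
      forall p q q', c p q <= c p q' + mdist q' q,
      forall p p' q, mdist p p' <= c p q + c p' q &
      forall p q q', mdist q q' <= c p q + c p q'].

Lemma coupling_sym P Q (c : P -> Q -> R) : coupling c -> coupling (fun q p => c p q).
Proof.
move=> [c0 c1 c2 c3 c4]; split=> //.
- by move=> q q' p; rewrite addrC metric_sym.
- by move=> q p p'; rewrite addrC metric_sym.
Qed.

Lemma coupling_ge0 P Q (c : P -> Q -> R) p q : coupling c -> 0 <= c p q.
Proof. by move=> [_ _ _ /(_ p p q) + _]; rewrite mdistxx; lra. Qed.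

Lemma coupling_point P Q (c : P -> Q -> R) p q : coupling c ->
  mdist (pm_point Q) q <= mdist (pm_point P) p + c p q.
Proof.
move=> [c0 c1 _ _ c4]; have := c4 (pm_point P) (pm_point Q) q.
by have := c1 (pm_point P) p q; lra.
Qed.

Lemma embedding_coupling P Q Z (f : P -> Z) (g : Q -> Z) :
  pointed_embedding f -> pointed_embedding g ->
  coupling (fun p q => mdist (f p) (g q)).
Proof.
move=> [fi f0] [gi g0]; split.
- by rewrite f0 g0 mdistxx.
- by move=> p p' q; rewrite -fi metric_triangle.
- by move=> p q q'; rewrite -gi metric_triangle.
- by move=> p p' q; rewrite -fi (metric_sym (f p')) metric_triangle.
- by move=> p q q'; rewrite -gi (metric_sym (f p) (g q)) metric_triangle.
Qed.

(** With [c] as cross distance, the disjoint union is a pseudometric space; its metric quotient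
    identifies the two base points. *)
Lemma coupling_embedding P Q (c : P -> Q -> R) : coupling c ->
  exists Z (f : P -> Z) (g : Q -> Z), [/\ pointed_embedding f,
    pointed_embedding g & forall p q, mdist (f p) (g q) = c p q].
Proof.
move=> [c0 c1 c2 c3 c4].
pose d (x y : (P + Q)%type) := match x, y with
  | inl p, inl p' => mdist p p'
  | inr q, inr q' => mdist q q'
  | inl p, inr q => c p q
  | inr q, inl p => c p q
  end.
have dxx x : d x x = 0 by case: x => x /=; rewrite mdistxx.
have dsym x y : d x y = d y x.
  by case: x => x; case: y => y //=; rewrite metric_sym.
have dtri y x z : d x z <= d x y + d y z.
  case: x => x; case: y => y; case: z => z //=; rewrite ?metric_triangle//.
  - by rewrite addrC metric_sym.
  - by rewrite addrC metric_sym.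
pose Z : pmetric R := @PMetric R (metric_quotient dxx dsym dtri)
  (quotient_class dxx dsym dtri (inl (pm_point P))).
exists Z, (fun p => quotient_class dxx dsym dtri (inl p)),
  (fun q => quotient_class dxx dsym dtri (inr q)).
split.
- by split=> // p p'; rewrite mdist_quotient_class.
- split; first by move=> q q'; rewrite mdist_quotient_class.
  by apply: mdist_positivity; rewrite mdist_quotient_class.
- by move=> p q; rewrite mdist_quotient_class.
Qed.

(** This glues along [Q]: the new cross distance is the infimum of [c p q + c' q t] over [q]. *)
Lemma coupling_comp P Q T (c : P -> Q -> R) (c' : Q -> T -> R) :
  coupling c -> coupling c' ->
  exists2 c'' : P -> T -> R, coupling c'' &
    forall p q t, c'' p t <= c p q + c' q t.
Proof.
move=> cc cc'; have [c0 c1 c2 c3 c4] := cc; have [c'0 c'1 c'2 c'3 c'4] := cc'.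
pose A p t := [set c p q + c' q t | q in setT].
have A0 p t : A p t !=set0 by exists (c p (pm_point Q) + c' (pm_point Q) t), (pm_point Q).
have Alb p t : lbound (A p t) 0.
  by move=> _ [q _ <-]; rewrite addr_ge0// (coupling_ge0 _ _ cc, coupling_ge0 _ _ cc').
have infle p q t : inf (A p t) <= c p q + c' q t.
  by apply: ge_inf; [exists 0; exact: Alb|exists q].
have infge p t a : (forall q, a <= c p q + c' q t) -> a <= inf (A p t).
  by move=> H; apply: lb_le_inf => // _ [q _ <-].
exists (fun p t => inf (A p t)) => //; split.
- apply/eqP; rewrite eq_le (lb_le_inf (A0 _ _) (Alb _ _)) andbT.
  by rewrite (le_trans (infle _ (pm_point Q) _))// c0 c'0 addr0.
- move=> p p' t; rewrite -lerBlDl; apply: infge => q.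
  by have := infle p q t; have := c1 p p' q; lra.
- move=> p t t'; rewrite -lerBlDr; apply: infge => q.
  by have := infle p q t; have := c'2 q t t'; lra.
(* The two infima involve different points [q] and [q'], whose distance is at most
   [c' q' t + c' q t]. *)
- move=> p p' t; rewrite -lerBlDl; apply: (infge p' t) => q'.
  rewrite lerBlDr -lerBlDl; apply: infge => q.
  have := c3 p p' q; have := c1 p' p' q; have := c2 p' q q'.
  by have := c'3 q' q t; rewrite mdistxx; lra.
- move=> p t t'; rewrite -lerBlDl; apply: (infge p t') => q'.
  rewrite lerBlDr -lerBlDl; apply: infge => q.
  have := c'4 q t t'; have := c'1 q q' t'; have := c4 p q q'.
  by lra.
Qed.

(** For [e > 0], points within [e^-1] of one base point have partners at distance at most [e].
    Convergence for [dpGH] and for [DGH] will both be expressed by this relation. *)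
Definition gh_close (e : R) P Q : Prop := exists c : P -> Q -> R, [/\ coupling c,
  forall p, e * mdist (pm_point P) p <= 1 -> exists q, c p q <= e &
  forall q, e * mdist (pm_point Q) q <= 1 -> exists p, c p q <= e].

Lemma gh_close_sym e P Q : gh_close e P Q -> gh_close e Q P.
Proof.
by move=> [c [cc cP cQ]]; exists (fun q p => c p q); split => //; exact: coupling_sym.
Qed.

(** A point within [1 / (2 * e)] of the base point has a partner within [1 / (2 * e) + e] of the
    next one; this is at most [1 / e] exactly when [2 * e ^+ 2 <= 1]. *)
Lemma gh_close_trans e P Q T : 0 < e -> 2 * e ^+ 2 <= 1 ->
  gh_close e P Q -> gh_close e Q T -> gh_close (2 * e) P T.
Proof.
have half P1 P2 P3 (c1 : P1 -> P2 -> R) (c2 : P2 -> P3 -> R) p :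
    0 < e -> 2 * e ^+ 2 <= 1 ->
    coupling c1 -> (forall p, e * mdist (pm_point P1) p <= 1 -> exists q, c1 p q <= e) ->
    (forall p, e * mdist (pm_point P2) p <= 1 -> exists q, c2 p q <= e) ->
    2 * e * mdist (pm_point P1) p <= 1 -> exists q t, c1 p q + c2 q t <= 2 * e.
  move=> e0 e1 cc1 H1 H2 ep; have d0 := mdist_ge0 (pm_point P1) p.
  have [|q pq] := H1 p; first by nra.
  have [|t qt] := H2 q; last by exists q, t; lra.
  by have := coupling_point p q cc1; rewrite expr2 in e1; nra.
move=> e0 e1 [c [cc cP cQ]] [c' [cc' cQ' cT]].
have [c'' cc'' c''le] := coupling_comp cc cc'.
exists c''; split => // [p ep|t et].
  have [q [t H]] := half _ _ _ _ _ p e0 e1 cc cP cQ' ep.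
  by exists t; rewrite (le_trans (c''le p q t)).
have [q [p H]] := half _ _ _ _ _ t e0 e1 (coupling_sym cc') cT cQ et.
by exists p; rewrite (le_trans (c''le p q t))// addrC.
Qed.

(** The rescaled space itself is the common space, with the inclusion and the identity as
    embeddings. *)
Lemma gh_close_subset (X : metricType R) (x : X) (A : set X) (Ax : A x)
    (l : {posnum R}) e : 0 < e ->
  (forall p, e * (l%:num * mdist x p) <= 1 ->
    exists2 a, A a & l%:num * mdist p a <= e) ->
  gh_close e (scaled_pt l (subset_pt Ax)) (scaled_pt l (PMetric x)).
Proof.
move=> e0 dense.
pose f (a : scaled_pt l (subset_pt Ax)) : X := set_val a.
have fE : @pointed_embedding _ _ (scaled_pt l (PMetric x)) f.
  split=> [a b|//].
  have -> : mdist a b = l%:num * mdist (set_val a) (set_val b) by [].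
  by [].
have idE : pointed_embedding (@id (scaled_pt l (PMetric x))) by split.
exists (fun a p => mdist (f a : scaled_pt l (PMetric x)) p).
split; first exact: (embedding_coupling fE idE).
- by move=> a _; exists (f a); rewrite mdistxx ltW.
- move=> p /dense[a Aa pa]; exists (SigSub (mem_set Aa)).
  by rewrite metric_sym.
Qed.

Section excess.
Variables (Z : metricType R) (z : Z) (A B : set Z).

Lemma excess_lt (r e : R) : (excess (A `&` cball z r) B < e%:E)%E ->
  forall a, A a -> mdist z a <= r -> exists2 b, B b & mdist a b < e.
Proof.
rewrite /excess gt_max => /andP[_ H] a Aa za.
have : (ereal_inf [set (mdist a b)%:E | b in B] < e%:E)%E.
  by apply: le_lt_trans H; apply: ereal_sup_ubound; exists a.
by move=> /ereal_inf_lt[_ [b Bb <-]]; rewrite lte_fin => ?; exists b.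
Qed.

Lemma excess_le (r e : R) : 0 <= e ->
  (forall a, A a -> mdist z a <= r -> exists2 b, B b & mdist a b <= e) ->
  (excess (A `&` cball z r) B <= e%:E)%E.
Proof.
move=> e0 H; rewrite /excess ge_max lee_fin e0/=.
apply: ge_ereal_sup => _ [a [Aa za] <-]; have [b Bb ab] := H _ Aa za.
by apply: ge_ereal_inf; exists (mdist a b)%:E; [exists b|rewrite lee_fin].
Qed.

End excess.

(** The factor [r^-1] in [excess_dist] turns [e / r] into the excess bound [e]. Strictness yields an
    actual nearby point although infima need not be attained. *)
Lemma excess_dist_lt_close (e : R) P Q Z (f : P -> Z) (g : Q -> Z) (r : R) :
  0 < e -> e^-1 <= r -> pointed_embedding f -> pointed_embedding g ->
  (excess_dist (pm_point Z) r (range f) (range g) < (e / r)%:E)%E ->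
  gh_close e P Q.
Proof.
move=> e0 er fE gE; have r0 : 0 < r by rewrite (lt_le_trans _ er) ?invr_gt0.
rewrite /excess_dist lte_pdivrMl// -EFinM mulrC divfK ?gt_eqF// gt_max => /andP[H1 H2].
have er1 x : e * x <= 1 -> x <= r.
  by move=> ex; apply: le_trans er; rewrite -[_^-1]mul1r ler_pdivlMr// mulrC.
exists (fun p q => mdist (f p) (g q)); split; first exact: embedding_coupling.
- move=> p /er1 pr; have [||_ [q _ <-]] := excess_lt H1 (a := f p).
  + by exists p.
  + by rewrite -fE.2 fE.1.
  + by move=> ?; exists q; exact: ltW.
- move=> q /er1 qr; have [||_ [p _ <-]] := excess_lt H2 (a := g q).
  + by exists q.
  + by rewrite -gE.2 gE.1.
  + by move=> ?; exists p; rewrite metric_sym ltW.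
Qed.

Lemma close_excess_dist (e : R) P Q (r : R) : 0 < e -> 0 < r -> e * r <= 1 ->
  gh_close e P Q -> exists Z (f : P -> Z) (g : Q -> Z),
    [/\ pointed_embedding f, pointed_embedding g &
    (excess_dist (pm_point Z) r (range f) (range g) <= (e / r)%:E)%E].
Proof.
move=> e0 r0 er [c [cc cP cQ]].
have [Z [f [g [fE gE fg]]]] := coupling_embedding cc.
exists Z, f, g; split=> //.
have er1 x : x <= r -> e * x <= 1.
  by move=> xr; apply: le_trans er; rewrite ler_pM2l.
rewrite /excess_dist lee_pdivrMl// -EFinM mulrC divfK ?gt_eqF// ge_max.
apply/andP; split; apply: excess_le; rewrite ?(ltW e0)//.
- move=> _ [p _ <-]; rewrite -fE.2 fE.1 => /er1/cP[q pq].
  by exists (g q); [exists q|rewrite fg].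
- move=> _ [q _ <-]; rewrite -gE.2 gE.1 => /er1/cQ[p pq].
  by exists (f p); [exists p|rewrite metric_sym fg].
Qed.

Lemma dpGH_lt_close e P Q : 0 < e <= 1 -> (dpGH P Q < e%:E)%E -> gh_close e P Q.
Proof.
move=> /andP[e0 e1] /ereal_inf_lt[_ [Z [f [g [fE gE ->]]]]].
(* The default value 1 is excluded because it is not below [e <= 1]. *)
rewrite /pointed_dist; case: ifPn => [_|_].
  by rewrite lte_fin ltNge e1.
move=> /ereal_inf_lt[_ [e' [/andP[e'0 e'1] H] <-]]; rewrite lte_fin => e'e.
apply: (excess_dist_lt_close e0 _ fE gE (r := e'^-1)).
  by rewrite lef_pV2 ?posrE// ltW.
by rewrite (le_lt_trans H)// invrK lte_fin expr2 ltr_pM2r.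
Qed.

Lemma close_dpGH e P Q : 0 < e <= 1 -> gh_close e P Q -> (dpGH P Q <= e%:E)%E.
Proof.
move=> /andP[e0 e1] PQ.
have ie0 : 0 < e^-1 by rewrite invr_gt0.
have [|Z [f [g [fE gE H]]]] := close_excess_dist e0 ie0 _ PQ.
  by rewrite divff// gt_eqF.
apply: (@le_trans _ _ (pointed_dist (pm_point Z) (range f) (range g))).
  by apply: ereal_inf_lbound; exists Z, f, g.
rewrite invrK -expr2 in H.
rewrite /pointed_dist; case: ifPn => [/eqP S0|_].
  by have : (set0 : set R) e by rewrite -S0; split; rewrite ?e0.
by apply: ereal_inf_lbound; exists e; split; rewrite ?e0.
Qed.

Lemma DGH_lt_close e P Q : 0 < e ->
  (DGH e^-1 P Q < (e ^+ 2)%:E)%E -> gh_close e P Q.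
Proof.
move=> e0 /ereal_inf_lt[_ [Z [f [g [fE gE ->]]]]] H.
by apply: (excess_dist_lt_close e0 (lexx _) fE gE); rewrite invrK -expr2.
Qed.

Lemma close_DGH e r P Q : 0 < e -> 0 < r -> e * r <= 1 ->
  gh_close e P Q -> (DGH r P Q <= (e / r)%:E)%E.
Proof.
move=> e0 r0 er PQ; have [Z [f [g [fE gE H]]]] := close_excess_dist e0 r0 er PQ.
by apply: le_trans H; apply: ereal_inf_lbound; exists Z, f, g.
Qed.

End couplings.

(** * Compactness and uniqueness of limits *)

Section limits.
Context {R : realType}.
Implicit Types (P W Y : pmetric R) (e rho : R).

Definition balls_totally_bounded (Y : pmetric R) : Prop :=
  forall rho e, 0 < e -> exists N : nat, forall l : seq Y,
    {in l, forall y, mdist (pm_point Y) y <= rho} ->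
    pairwise (fun y y' => e < mdist y y') l -> (size l < N)%N.

(** If the ball about a point [p] of [B] is not in [F], its complement is. A separated list there
    can be prolonged by [p], so the bound drops by one. *)
Lemma maximal_filter_small_ball (Y : metricType R) (F : set_system Y) e (N : nat)
    (B : set Y) : ProperFilter F -> (forall A, F A \/ F (~` A)) -> F B ->
  (forall l : seq Y, {in l, forall y, B y} ->
    pairwise (fun y y' => e < mdist y y') l -> (size l < N)%N) ->
  exists y, F [set z | mdist y z <= e].
Proof.
move=> FF Fmax; elim: N B => [|N IH] B FB HB.
  by have : (size (@nil Y) < 0)%N by exact: HB.
have [p Bp] := filter_ex FB.
have [Fp|Fp] := Fmax [set z | mdist p z <= e]; first by exists p.
apply: (IH (B `&` ~` [set z | mdist p z <= e])); first exact: filterI.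
move=> l lB lsep; apply: (HB (p :: l)).
  by move=> y; rewrite inE => /predU1P[->//|/lB[]].
rewrite /= lsep andbT; apply/allP => y /lB[_ /negP].
by rewrite -ltNge.
Qed.

Lemma maximal_filter_cvg (Y : pmetric R) (F : set_system Y) rho :
  complete_metric Y -> balls_totally_bounded Y ->
  ProperFilter F -> (forall A, F A \/ F (~` A)) ->
  F [set y | mdist (pm_point Y) y <= rho] -> exists y : Y, F --> y.
Proof.
move=> Yc Yb FF Fmax Frho; apply: (Yc F FF); apply: cauchy_exP => e e0.
have e20 : 0 < e / 2 by rewrite divr_gt0.
have [N HN] := Yb rho _ e20.
have [y Fy] := maximal_filter_small_ball FF Fmax Frho HN.
exists y; rewrite ballEmdist; apply: filterS Fy => z /= yz; lra.
Qed.

Lemma mdist_le_eq (Y : metricType R) (y y' : Y) :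
  (forall e, 0 < e -> mdist y y' <= e) -> y = y'.
Proof.
move=> H; apply: mdist_positivity; apply/eqP; rewrite eq_le mdist_ge0 andbT.
by apply/ler_addgt0Pr => e e0; rewrite add0r; exact: H.
Qed.

(* An ultrafilter on the indices replaces the diagonal extraction of the
   Arzela-Ascoli argument. *)
Lemma limit_map (U : set_system nat) W Y (c : nat -> W -> Y -> R) :
  UltraFilter U -> (\oo `<=` U) -> complete_metric Y -> balls_totally_bounded Y ->
  (forall n, coupling (c n)) ->
  (forall n w, n.+1%:R^-1 * mdist (pm_point W) w <= 1 ->
    exists y, c n w y <= n.+1%:R^-1) ->
  exists f : W -> Y, forall w e, 0 < e -> U [set n | c n w (f w) <= e].
Proof.
move=> UU ooU Yc Yb cc H.
have invS_small e : 0 < e -> \forall n \near \oo, n.+1%:R^-1 <= e :> R.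
  move=> e0; near=> n; rewrite invf_ple ?posrE//; near: n.
  exists (Num.truncn e^-1) => // n /= en.
  by rewrite ltW// (lt_le_trans (truncnS_gt _))// ler_nat.
suff /choice[f Hf] w : exists y, forall e, 0 < e -> U [set n | c n w y <= e].
  by exists f.
pose t : R := mdist (pm_point W) w.
have near_t : \forall n \near \oo, n.+1%:R^-1 * t <= 1 :> R.
  near=> n; rewrite mulrC ler_pdivrMr// mul1r; near: n.
  exists (Num.truncn t) => // n /= tn.
  by rewrite ltW// (lt_le_trans (truncnS_gt _))// ler_nat.
(* Partners of [w]; the base point is a placeholder for the early indices, which [U] ignores. *)
have /choice[g Hg] n : exists y, n.+1%:R^-1 * t <= 1 -> c n w y <= n.+1%:R^-1.
  have [nt|nt] := pselect (n.+1%:R^-1 * t <= 1 :> R).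
    by have [y Hy] := H n w nt; exists y.
  by exists (pm_point Y).
have UF : ProperFilter U := @ultra_proper _ _ UU.
have gt : (g @ U) [set y | mdist (pm_point Y) y <= t + 1].
  rewrite /fmap/=; apply: ooU; near=> n => /=.
  have := coupling_point w (g n) (cc n).
  have : c n w (g n) <= n.+1%:R^-1 by apply: Hg; near: n.
  have : n.+1%:R^-1 <= 1 :> R by near: n; exact: invS_small.
  by move=> h1 h2 h3; rewrite (le_trans h3)// lerD2l (le_trans h2).
have gmax A : (g @ U) A \/ (g @ U) (~` A).
  exact: (in_ultra_setVsetC (g @^-1` A) UU).
have [y gy] := maximal_filter_cvg Yc Yb _ gmax gt.
exists y => e e0; have e20 : 0 < e / 2 by rewrite divr_gt0.
have U1 : U [set n | mdist y (g n) < e / 2].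
  by apply: (metricType_numDomainType.cvgr_dist_lt gy).
have U2 : U [set n | n.+1%:R^-1 * t <= 1 /\ n.+1%:R^-1 <= e / 2 :> R].
  by apply: ooU; apply: filterI => //; exact: invS_small.
apply: filterS (filterI U1 U2) => n /= [yg [/Hg cg ne]].
have [_ _ c2 _ _] := cc n.
by have := le_trans cg ne; have := c2 w y (g n); rewrite (metric_sym (g n)); lra.
Unshelve. all: by end_near. Qed.

(** Couplings with error [n.+1%:R^-1] give limit maps in both directions along one ultrafilter. Any
    finitely many approximations then hold at a common index, where the coupling inequalities make
    [f] isometric and [g] its inverse. *)
Lemma gh_close_isometric W Y :
  complete_metric W -> balls_totally_bounded W ->
  complete_metric Y -> balls_totally_bounded Y ->
  (forall e, 0 < e <= 1 -> gh_close e W Y) -> pointed_isometric W Y.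
Proof.
move=> Wc Wb Yc Yb H.
have invS n : 0 < (n.+1%:R^-1 : R) <= 1 by rewrite invr_gt0 ltr0n invf_le1// ler1n.
have /choice[c Hc] n := H _ (invS n).
have cc n : coupling (c n) by have [] := Hc n.
have [U [UU ooU]] := @ultraFilterLemma nat \oo _.
have UF : ProperFilter U := @ultra_proper _ _ UU.
have ex1 A : U A -> exists n, A n by move=> UA; exact: filter_ex UA.
have ex2 A B : U A -> U B -> exists n, A n /\ B n.
  by move=> UA UB; exact: filter_ex (filterI UA UB).
have [|f Hf] := limit_map UU ooU Yc Yb cc.
  by move=> n; have [] := Hc n.
have [|g Hg] := limit_map UU ooU Wc Wb (fun n => coupling_sym (cc n)).
  by move=> n; have [] := Hc n.
have both (w : W) (y : Y) e : 0 < e -> exists n, c n w (f w) <= e /\ c n (g y) y <= e.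
  by move=> e0; exact: ex2 (Hf w e e0) (Hg y e e0).
exists f; split; first split.
- move=> w w'.
  have two e : 0 < e -> exists n, c n w (f w) <= e /\ c n w' (f w') <= e.
    by move=> e0; exact: ex2 (Hf w e e0) (Hf w' e e0).
  apply/eqP; rewrite eq_le; apply/andP; split; apply/ler_addgt0Pr => e e0.
    have e20 : 0 < e / 2 by rewrite divr_gt0.
    have [n [cw cw']] := two _ e20; have [_ c1 _ _ c4] := cc n.
    by have := c4 w (f w) (f w'); have := c1 w w' (f w'); lra.
  have e20 : 0 < e / 2 by rewrite divr_gt0.
  have [n [cw cw']] := two _ e20; have [_ _ c2 c3 _] := cc n.
  have := c3 w w' (f w); have := c2 w' (f w) (f w').
  by rewrite (metric_sym (f w')); lra.
- apply/esym/mdist_le_eq => e e0.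
  have [n cn] := ex1 _ (Hf (pm_point W) e e0); have [c0 _ _ _ c4] := cc n.
  have := c4 (pm_point W) (pm_point Y) (f (pm_point W)).
  by rewrite c0 add0r => /le_trans; apply.
- exists g => [w|y].
    apply: mdist_le_eq => e e0; have e20 : 0 < e / 2 by rewrite divr_gt0.
    have [n [cw cy]] := both w (f w) _ e20; have [_ _ _ c3 _] := cc n.
    by have := c3 (g (f w)) w (f w); lra.
  apply: mdist_le_eq => e e0; have e20 : 0 < e / 2 by rewrite divr_gt0.
  have [n [cw cy]] := both (g y) y _ e20; have [_ _ _ _ c4] := cc n.
  by have := c4 (g y) (f (g y)) y; lra.
Qed.

Lemma pointed_isometric_sym W Y : pointed_isometric W Y -> pointed_isometric Y W.
Proof.
move=> [f [[fi f0] [g fg gf]]]; exists g; split; last by exists f.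
by split=> [y y'|]; [rewrite -fi !gf|rewrite -f0 fg].
Qed.

Lemma pointed_isometric_trans W Y P : pointed_isometric W Y ->
  pointed_isometric Y P -> pointed_isometric W P.
Proof.
move=> [f [[fi f0] fb]] [g [[gi g0] gb]]; exists (g \o f); split.
  by split=> [w w' /=|/=]; [rewrite gi fi|rewrite f0 g0].
exact: bij_comp.
Qed.

Lemma pointed_class_eq W Y : pointed_isometric W Y -> pointed_class W = pointed_class Y.
Proof.
move=> WY; apply/funext => V; apply/propext; split=> H.
  exact: pointed_isometric_trans H WY.
exact: pointed_isometric_trans H (pointed_isometric_sym WY).
Qed.

End limits.

(** * Tangents at good points *)

Section ereal_limits.
Context {R : realType}.
Implicit Types u : nat -> \bar R.

Lemma cvge0_near_lt u (e : R) : 0 < e -> u i @[i --> \oo] --> 0%E ->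
  \forall i \near \oo, (u i < e%:E)%E.
Proof.
move=> e0 u0; apply: (u0 [set y | (y < e%:E)%E]).
by apply: open_nbhs_nbhs; split; [exact: open_ereal_lt_ereal|rewrite /= lte_fin].
Qed.

Lemma near_le_cvge0 u : (forall i, 0 <= u i)%E ->
  (forall e : R, 0 < e -> \forall i \near \oo, (u i <= e%:E)%E) ->
  u i @[i --> \oo] --> 0%E.
Proof.
move=> u0 ue; apply/fine_cvgP; split.
  have := ue 1 ltr01; apply: filterS => i ui.
  by rewrite ge0_fin_numE// (le_lt_trans ui)// ltry.
apply/cvgr0Pnorm_le => e e0; have := ue e e0; apply: filterS => i ui.
have ufin : u i \is a fin_num by rewrite ge0_fin_numE// (le_lt_trans ui)// ltry.
by rewrite ger0_norm ?fine_ge0// -lee_fin fineK.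
Qed.

End ereal_limits.

Section gh_limits.
Context {R : realType}.
Implicit Types (P : nat -> pmetric R) (Y : pmetric R) (e rho : R).

Lemma dpGH_ge0 (Q Y : pmetric R) : (0 <= dpGH Q Y)%E.
Proof.
apply: le_ereal_inf_tmp => _ [Z [f [g [_ _ ->]]]].
rewrite /pointed_dist; case: ifPn => // _.
by apply: le_ereal_inf_tmp => _ [e [/andP[e0 _] _] <-]; rewrite lee_fin ltW.
Qed.

Lemma DGH_ge0 rho (Q Y : pmetric R) : 0 < rho -> (0 <= DGH rho Q Y)%E.
Proof.
move=> r0; apply: le_ereal_inf_tmp => _ [Z [f [g [_ _ ->]]]].
rewrite /excess_dist mule_ge0// ?lee_fin ?invr_ge0 ?(ltW r0)//.
by rewrite le_max /excess le_max lexx.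
Qed.

Lemma cvg_dpGHP P Y : dpGH (P i) Y @[i --> \oo] --> 0%E <->
  forall e, 0 < e <= 1 -> \forall i \near \oo, gh_close e (P i) Y.
Proof.
split=> [H e e01|H].
  have /andP[e0 _] := e01; have := cvge0_near_lt e0 H.
  by apply: filterS => i; exact: dpGH_lt_close.
apply: near_le_cvge0 => [i|e e0]; first exact: dpGH_ge0.
have e1 : 0 < Num.min e 1 <= 1 by rewrite lt_min e0 ltr01 ge_min lexx orbT.
have := H _ e1; apply: filterS => i /(close_dpGH e1) /le_trans; apply.
by rewrite lee_fin ge_min lexx.
Qed.

(** With [cvg_dpGHP], this identifies [DGH] convergence at all radii with [dpGH] convergence. *)
Lemma cvg_DGHP P Y :
  (forall rho, 0 < rho -> DGH rho (P i) Y @[i --> \oo] --> 0%E) <->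
  forall e, 0 < e <= 1 -> \forall i \near \oo, gh_close e (P i) Y.
Proof.
split=> [H e /andP[e0 _]|H rho rho0].
  have ie0 : 0 < e^-1 by rewrite invr_gt0.
  have e20 : 0 < e ^+ 2 by rewrite exprn_gt0.
  have := cvge0_near_lt e20 (H _ ie0).
  by apply: filterS => i; exact: DGH_lt_close.
apply: near_le_cvge0 => [i|e e0]; first exact: DGH_ge0.
(* The bound [rho^-1] places the ball of radius [rho] within radius [t^-1]; the bound [e * rho]
   makes [t / rho <= e]. *)
pose t := Num.min (e * rho) (Num.min rho^-1 1).
have t0 : 0 < t by rewrite !lt_min mulr_gt0// invr_gt0 rho0/=.
have t1 : 0 < t <= 1 by rewrite t0 !ge_min lexx !orbT.
have tr : t * rho <= 1.
  by rewrite -ler_pdivlMr// mul1r !ge_min lexx orbT.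
have := H _ t1; apply: filterS => i /(close_DGH t0 rho0 tr) /le_trans; apply.
by rewrite lee_fin ler_pdivrMr// ge_min lexx.
Qed.

End gh_limits.

Section tangents.
Context {R : realType} (X : metricType R).
Implicit Types (s K : R) (x : X) (W Y : pmetric R) (r : nat -> {posnum R}).

Lemma not_thin_at s K x : ~ thin_at s K x -> exists c eta,
  [/\ 0 < c, 0 < eta & forall t p, 0 < t < eta -> mdist x p <= K * t ->
    ((c * t `^ s)%:E <= hausdorff_measure s (cball p (t / K)))%E].
Proof.
move=> nthin; apply: contrapT => H; apply: nthin => c eta c0 eta0.
apply: contrapT => H'; apply: H; exists c, eta; split=> // t p t0 xp.
by rewrite leNgt; apply/negP => lt; apply: H'; exists t, p.
Qed.

Lemma not_crowded_at K x : ~ crowded_at K x -> exists (N : nat) eta,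
  0 < eta /\ forall t l, 0 < t < eta -> {in l, forall p, mdist x p <= K * t} ->
    pairwise (fun p q => t / K < mdist p q) l -> size l <> N.
Proof.
move=> ncr; apply: contrapT => H; apply: ncr => N eta eta0.
apply: contrapT => H'; apply: H; exists N, eta; split=> // t l t0 xl lsep sl.
by apply: H'; exists t, l.
Qed.

Lemma scales_to0_near_lt r (e : R) : scales_to0 r -> 0 < e ->
  \forall i \near \oo, (r i)%:num < e.
Proof.
move=> r0 e0; have /cvgr0Pnorm_lt/(_ _ e0) := r0.
by apply: filterS => i; rewrite ger0_norm.
Qed.

(* A point of [X] far from [A i] is the centre of a ball avoiding [A i], whose
   measure is not negligible since [x] is not thin. *)
Lemma app_tangent_along_dpGH s x Y r : (forall k : nat, ~ thin_at s k.+1%:R x) ->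
  scales_to0 r -> app_tangent_along s x Y r ->
  dpGH (scaled_pt ((r i)%:num^-1%:pos) (PMetric x)) Y @[i --> \oo] --> 0%E.
Proof.
move=> nthin r0 [A [Ax HA]]; apply/cvg_dpGHP => e /andP[e0 e1].
have AY : forall e, 0 < e <= 1 -> \forall i \near \oo,
    gh_close e (scaled_pt ((r i)%:num^-1%:pos) (subset_pt (Ax i))) Y.
  by apply/cvg_DGHP => rho rho0; have [] := HA rho rho0.
have e2 : 0 < e / 2 <= 1 by rewrite divr_gt0//=; lra.
have e20 : 0 < e / 2 by rewrite divr_gt0.
(* An integer above [2 / e]: it bounds the rescaled distances to be considered, and [K^-1] is within
   the allowed error [e / 2]. *)
pose K : R := (Num.truncn (e / 2)^-1).+1%:R.
have Ke : K^-1 <= e / 2.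
  by rewrite invf_ple ?posrE// /K ltW// truncnS_gt.
have K1 : 1 <= K by rewrite ler1n.
have K0 : 0 < K by rewrite (lt_le_trans ltr01).
have [c [eta [c0 eta0 Hc]]] := not_thin_at (nthin (Num.truncn (e / 2)^-1)).
have K10 : 0 < K + 1 by rewrite addr_gt0.
have [Hmeas _] := HA _ K10.
(* The lower bound [c * t ^ s] from [Hc], divided by the normalisation at radius [(K + 1) * t]; that
   radius captures every ball [cball p (t / K)] with [mdist x p <= K * t]. *)
have q0 : 0 < c / (2 * (K + 1)) `^ s.
  by rewrite divr_gt0// powR_gt0// mulr_gt0.
near=> i.
have cl : gh_close (e / 2) (scaled_pt ((r i)%:num^-1%:pos) (subset_pt (Ax i))) Y.
  by near: i; exact: AY.
have reta : (r i)%:num < eta by near: i; exact: scales_to0_near_lt.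
have Hi : (hausdorff_measure s (cball x ((K + 1) * (r i)%:num) `\` A i) *
    ((2 * (K + 1) * (r i)%:num) `^ s)^-1%:E < (c / (2 * (K + 1)) `^ s)%:E)%E.
  by near: i; exact: cvge0_near_lt.
have t0 : 0 < (r i)%:num by [].
set t := (r i)%:num in t0 reta Hi *.
rewrite (_ : e = 2 * (e / 2)); last by field.
apply: gh_close_trans (gh_close_sym _) cl => //; first by rewrite expr2; nra.
apply: gh_close_subset => // p /= ep.
have xp : mdist x p <= K * t.
  have ei : (e / 2)^-1 <= K by rewrite /K ltW// truncnS_gt.
  have : t^-1 * mdist x p <= K.
    by apply: le_trans ei; rewrite -[leRHS]mul1r ler_pdivlMr// mulrC.
  by rewrite mulrC ler_pdivrMr.
apply: contrapT => nA.
have sub : cball p (t / K) `<=` cball x ((K + 1) * t) `\` A i.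
  move=> q; rewrite /cball /= => pq.
  have tK : t / K <= t by rewrite ler_pdivrMr// ler_peMr// ltW.
  split.
    by rewrite (le_trans (metric_triangle x p q))// mulrDl mul1r lerD// (le_trans pq).
  move=> Aq; apply: nA; exists q => //.
  by rewrite mulrC ler_pdivrMr// (le_trans pq)// mulrC ler_pM2r.
have t_eta : 0 < t < eta by rewrite t0.
have H1 := le_trans (Hc t p t_eta xp) (le_hausdorff_measure s sub).
have T0 : 0 < (2 * (K + 1) * t) `^ s by rewrite powR_gt0// !mulr_gt0.
move: Hi; rewrite lte_pdivrMr// => Hi.
have := le_lt_trans H1 Hi; rewrite -EFinM lte_fin.
rewrite [(_ * t) `^ s]powRM ?mulr_ge0 ?(ltW t0) ?(ltW K10)//.
by rewrite mulrA divfK ?ltxx// gt_eqF// powR_gt0// mulr_gt0.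
Unshelve. all: by end_near. Qed.

(** The whole space is taken as every subset, so nothing is removed. *)
Lemma dpGH_app_tangent_along s x Y r : 0 < s ->
  dpGH (scaled_pt ((r i)%:num^-1%:pos) (PMetric x)) Y @[i --> \oo] --> 0%E ->
  app_tangent_along s x Y r.
Proof.
move=> s0 /cvg_dpGHP XY; exists (fun=> setT), (fun=> I) => rho rho0; split.
  rewrite (_ : (fun _ => _) = fun=> 0%E); first exact: cvg_cst.
  by apply/funext => i; rewrite setDT hausdorff_measure0// mul0e.
move: rho rho0; apply/cvg_DGHP => e /andP[e0 e1].
have e20 : 0 < e / 2 by rewrite divr_gt0.
have e2 : 0 < e / 2 <= 1 by rewrite e20/=; lra.
have := XY _ e2; apply: filterS => i cl.
rewrite (_ : e = 2 * (e / 2)); last by field.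
apply: gh_close_trans cl => //; first by rewrite expr2; nra.
apply: gh_close_subset => // p _; exists p => //.
by rewrite mdistxx mulr0 ltW.
Qed.

(** A long separated list in [Y] has partners in a rescaled copy of [X], which would contradict that
    [x] is not crowded. *)
Lemma tangent_balls_totally_bounded x Y r :
  (forall k : nat, ~ crowded_at k.+1%:R x) -> scales_to0 r ->
  dpGH (scaled_pt ((r i)%:num^-1%:pos) (PMetric x)) Y @[i --> \oo] --> 0%E ->
  balls_totally_bounded Y.
Proof.
move=> ncr r0 /cvg_dpGHP XY rho e e0.
(* Partners lie within [rho + 1] of [x] after rescaling and stay [e / 2] apart; [K] exceeds both
   [rho + 1] and [2 / e]. *)
pose k := Num.truncn (`|rho| + 1 + 2 / e).
pose K : R := k.+1%:R.
have ie0 : 0 < 2 / e by rewrite divr_gt0.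
have Kgt : `|rho| + 1 + 2 / e < K by exact: truncnS_gt.
have rho_le := ler_norm rho; have rho0 := normr_ge0 rho.
have K0 : 0 < K by lra.
have [N [eta [eta0 HN]]] := not_crowded_at (ncr k).
exists N => l lrho lsep; rewrite ltnNge; apply/negP => Nl.
pose d := Num.min (e / 4) (Num.min 1 (`|rho| + 1)^-1).
have rho1 : 0 < `|rho| + 1 by lra.
have d0 : 0 < d by rewrite !lt_min divr_gt0//= ltr01 invr_gt0.
have d1 : 0 < d <= 1 by rewrite d0 !ge_min lexx !orbT.
have dle : d <= 1 by have /andP[] := d1.
have de : d <= e / 4 by rewrite ge_min lexx.
have drho y : y \in l -> d * mdist (pm_point Y) y <= 1.
  move=> /lrho yrho; have : d * (`|rho| + 1) <= 1.
    by rewrite -ler_pdivlMr// mul1r !ge_min lexx !orbT.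
  have := mdist_ge0 (pm_point Y) y; nra.
have [i [[c [cc _ cY]] ri]] : exists i,
    gh_close d (scaled_pt ((r i)%:num^-1%:pos) (PMetric x)) Y /\ (r i)%:num < eta.
  have near_i : \forall i \near \oo,
      gh_close d (scaled_pt ((r i)%:num^-1%:pos) (PMetric x)) Y /\ (r i)%:num < eta.
    by near=> i; split; near: i; [exact: XY|exact: scales_to0_near_lt].
  exact: filter_ex near_i.
have t0 : 0 < (r i)%:num by [].
set t := (r i)%:num in t0 ri.
have /choice[h Hh] y : exists p, d * mdist (pm_point Y) y <= 1 -> c p y <= d.
  have [/cY[p cp]|ny] := pselect (d * mdist (pm_point Y) y <= 1); first by exists p.
  by exists x.
have hl y : y \in l -> c (h y) y <= d by move=> yl; apply: Hh; exact: drho.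
(* [HN] excludes lists of exactly [N] points, hence the truncation. *)
apply: (HN t (map h (take N l))); rewrite ?t0 ?size_map ?size_takel//.
- move=> _ /mapP[y /mem_take yl ->].
  have := coupling_point y (h y) (coupling_sym cc).
  have -> : mdist (pm_point (scaled_pt ((r i)%:num^-1%:pos) (PMetric x))) (h y)
    = t^-1 * mdist x (h y) by [].
  move=> H; have := hl _ yl; have := lrho _ yl => yrho cd.
  have : t^-1 * mdist x (h y) <= K by lra.
  by rewrite mulrC ler_pdivrMr.
- rewrite pairwise_map; have lsep' := subseq_pairwise (take_subseq l N) lsep.
  have lP : all [in l] (take N l) by apply/allP => y /mem_take.
  apply: sub_in_pairwise lP lsep' => y y' yl y'l /= yy'; have [_ _ _ _ c4] := cc.
  have := c4 (h y) y y'; have [_ c1 _ _ _] := cc; have := c1 (h y) (h y') y'.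
  have -> : @mdist R (scaled_pt ((r i)%:num^-1%:pos) (PMetric x)) (h y) (h y')
    = t^-1 * mdist (h y : X) (h y') by [].
  have := hl _ yl; have := hl _ y'l => cy' cy cyy' cyyy'.
  have : e / 2 <= t^-1 * mdist (h y : X) (h y') by lra.
  rewrite [leRHS]mulrC ler_pdivlMr// => ed; apply: lt_le_trans ed.
  rewrite mulrC ltr_pM2r// invf_plt ?posrE ?divr_gt0//.
  by rewrite invf_div; lra.
Unshelve. all: by end_near. Qed.

(** At a late common index both limits are close to the same rescaled copy of [X], hence to each
    other. *)
Lemma tangent_unique x W Y r : (forall k : nat, ~ crowded_at k.+1%:R x) ->
  scales_to0 r -> complete_metric W -> complete_metric Y ->
  dpGH (scaled_pt ((r i)%:num^-1%:pos) (PMetric x)) W @[i --> \oo] --> 0%E ->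
  dpGH (scaled_pt ((r i)%:num^-1%:pos) (PMetric x)) Y @[i --> \oo] --> 0%E ->
  pointed_isometric W Y.
Proof.
move=> ncr r0 Wc Yc XW XY; apply: gh_close_isometric => //.
- exact: tangent_balls_totally_bounded XW.
- exact: tangent_balls_totally_bounded XY.
move=> e /andP[e0 e1].
have e20 : 0 < e / 2 by rewrite divr_gt0.
have e2 : 0 < e / 2 <= 1 by rewrite e20/=; lra.
have near_i : \forall i \near \oo,
    gh_close (e / 2) (scaled_pt ((r i)%:num^-1%:pos) (PMetric x)) W /\
    gh_close (e / 2) (scaled_pt ((r i)%:num^-1%:pos) (PMetric x)) Y.
  by near=> i; split; near: i; [move/cvg_dpGHP: XW|move/cvg_dpGHP: XY]; exact.
have [i [cW cY]] := filter_ex near_i.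
rewrite (_ : e = 2 * (e / 2)); last by field.
by apply: gh_close_trans (gh_close_sym cW) cY => //; rewrite expr2; nra.
Unshelve. all: by end_near. Qed.

End tangents.

(** The exceptional set lies in a countable union of thin and crowded sets, each of content 0 at
    every scale [d > 0]. *)
Lemma hausdorff_ae_good (R : realType) (X : metricType R) (s : R) (P : X -> Prop) :
  0 < s -> finite_packing_content X s ->
  (forall x, (forall k : nat, ~ thin_at s k.+1%:R x) ->
             (forall k : nat, ~ crowded_at k.+1%:R x) -> P x) ->
  hausdorff_ae s P.
Proof.
move=> s0 Xs HP; apply: hausdorff_measure_eq0 => d d0.
have PB : [set x | ~ P x] `<=` \bigcup_(p in [set: nat * bool])
    (if p.2 then [set x | thin_at s p.1.+1%:R x]
     else [set x : X | crowded_at p.1.+1%:R x]).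
  move=> x /= nP; apply: contrapT => nB; apply: nP; apply: HP => k bad; apply: nB.
    by exists (k, true).
  by exists (k, false).
apply/eqP; rewrite eq_le hausdorff_content_ge0 andbT.
apply: le_trans (le_hausdorff_content s d PB) _.
apply: le_trans (hausdorff_content_bigcup _ s0 (ltW d0) (countableP _)) _.
rewrite esum1// => -[k []] _ /=.
  by apply: hausdorff_content_thin.
by apply: hausdorff_content_crowded => //; rewrite ler1n.
Qed.

Theorem proposition6p5 (R : realType) (X : metricType R) (s : R) :
  0 < s ->
  finite_packing_content X s ->
  hausdorff_ae s (fun x : X =>
    AppTanGH x s = TanGH x /\
    (forall Y : pmetric R, strong_app_tangent s x Y ->
       TanGH x = (fun C => C = pointed_class Y))).
Proof.
move=> s0 Xs; apply: hausdorff_ae_good => // x nthin ncrowded; split.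
  apply/funext => C; apply/propext; split=> [[Y [-> [Yc [r [r0 HY]]]]]|].
    by exists Y; split=> //; exists r; split=> //; exact: app_tangent_along_dpGH HY.
  move=> [Y [-> Yc [r [r0 HY]]]]; exists Y; split=> //; split=> //.
  by exists r; split=> //; exact: dpGH_app_tangent_along.
move=> Y [Yc HY]; apply/funext => C; apply/propext; split.
  (* A strong tangent is available along the very scales that produce [W], so uniqueness applies. *)
  move=> [W [-> Wc [r [r0 HW]]]]; apply: pointed_class_eq.
  apply: (tangent_unique ncrowded r0 Wc Yc HW).
  exact: app_tangent_along_dpGH (HY r r0).
move=> ->; exists Y; split=> //.
(* One concrete sequence of scales shows that [Y] itself is a tangent. *)
have r0 : scales_to0 (fun i => i.+1%:R^-1%:pos : {posnum R}).
  exact: cvg_harmonic.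
by exists (fun i => i.+1%:R^-1%:pos); split=> //; exact: app_tangent_along_dpGH (HY _ r0).
Qed.
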